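(* Let $G$ be a simple digraph whose vertex set is a disjoint union $V_G=V\sqcup V'\sqcup W\sqcup X$ such that there is an isomorphism $\Phi\colon V\to V'$ between the subdigraphs induced by $V$ and $V'$, and such that the subdigraphs induced by $V$, $V'$ and $W$ have equitable partitions $V=\bigsqcup_{i=1}^{p}V_i$, $V'=\bigsqcup_{i=1}^{p}V_i'$ with $V_i'=\Phi(V_i)$, and $W=\bigsqcup_{k=1}^{q}W_k$. Suppose that for all $i,j\in\{1,\dots,p\}$, $k\in\{1,\dots,q\}$ and $x\in X$: (1) $x$ is unlinked or fully linked to $V_i$, and $V_i$ is unlinked or fully linked to $x$; (2) $x$ is unlinked or fully linked to $V_i'$, and $V_i'$ is unlinked or fully linked to $x$; (3) there exists $\delta_{V_i}\in\mathbb{Z}$ such that whenever $v\in V_i$ and $v'\in V_i'$, then $\delta_{V_i}=m_{v'\to X}-m_{v\to X}=m_{X\to v'}-m_{X\to v}$; (4) $x$ is unlinked, half-linked, or fully linked to $W_k$, and $W_k$ is unlinked, half-linked, or fully linked to $x$; (5) whenever $w,w'\in W_k$, then $m_{w\to X}=m_{w'\to X}$ and $m_{X\to w}=m_{X\to w'}$; (6) $V_i\sqcup V_i'$ is unlinked or fully linked to $W_k$, and $W_k$ is unlinked or fully linked to $V_i\sqcup V_i'$; (7) for every $v\in V_i$, there are edges from $v$ to $\Phi(v)$ and from $\Phi(v)$ to $v$, and there are no edges from $v$ to $V_i'\setminus\{\Phi(v)\}$ and none from $V_i'\setminus\{\Phi(v)\}$ to $v$; (8) if $i\ne j$ and $\delta_{V_i}\neq\delta_{V_j}$,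 then [either $V_i$ is unlinked to $V_j'$ and $V_i'$ is unlinked to $V_j$, or $V_i$ is fully linked to $V_j'$ and $V_i'$ is fully linked to $V_j$] and [either $V_i$ is unlinked to $V_j$ and $V_i'$ is unlinked to $V_j'$, or $V_i$ is fully linked to $V_j$ and $V_i'$ is fully linked to $V_j'$]; if $i\neq j$ and $\delta_{V_i}=\delta_{V_j}$, then one of the following three holds: $V_i$ is unlinked to $V_j'$ and $V_i'$ is unlinked to $V_j$; or $V_i$ is fully linked to $V_j'$ and $V_i'$ is fully linked to $V_j$; or $V_i$ is half-linked to $V_j'$, $V_i'$ is half-linked to $V_j$, $m_{V_i\to v'}=\frac12|V_i|$ for every $v'\in V_j'$, and for all $v\in V_i$, $v'\in V_j'$ there is an edge from $v$ to $v'$ if and only if there is no edge from $\Phi(v)\in V_i'$ to $\Phi^{-1}(v')\in V_j$. Let $G'$ be the simple digraph obtained from $G$ by performing all possible switchings of the form $(x,V_i\sqcup V_i')$, $(V_i\sqcup V_i',x)$, $(x,W_k)$ and $(W_k,x)$, where $x$ ranges over $X$ (and $i$, $k$ over all indices). Then $G$ and $G'$ are zeta-equivalent and have zeta-equivalent complements.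
   Context: Digraphs are finite; a simple digraph has no loops and no parallel edges (both $(v,v')$ and $(v',v)$ may be edges). For a digraph $H$ on $n_H$ vertices, $A_H$ is its adjacency matrix, and $D_H^{\mathrm{out}}$, $D_H^{\mathrm{in}}$ are the diagonal matrices of row sums of $A_H$ and $A_H^T$. The complement $H^{\mathrm c}$ of a simple digraph is given by $A_{H^{\mathrm c}}=J-I-A_H$ with $J$ the all-ones matrix. Zeta-equivalence: simple digraphs $H,H'$ with $n_H=n_{H'}$ are zeta-equivalent if $\eta_H=\eta_{H'}$, where $$\eta_H(x,t_\uparrow,t_\downarrow,u_\uparrow,u_\downarrow)=\det\big(xI_{n_H}+t_\uparrow D_H^{\mathrm{out}}+t_\downarrow D_H^{\mathrm{in}}+u_\uparrow A_H+u_\downarrow A_H^T\big).$$ (The paper defines zeta-equivalence by any of several conditions shown to be equivalent; this is one of them.) Notation: for sets of vertices $Y,Y'$, $m_{Y\to Y'}$ is the number of edges from $Y$ to $Y'$; braces are omitted for singletons. A partition $Y=Y_1\sqcup\dots\sqcup Y_r$ of the vertex set of a digraph (into nonempty parts) is equitable if for all $i,j$ and all $v,v'\in Y_i$ one has $m_{v\to Y_j}=m_{v'\to Y_j}$ and $m_{Y_j\to v}=m_{Y_j\to v'}$. A set $Y$ is unlinked, half-linked, or fully linked to a set $Y'$ if for every $v\in Y$ one has $m_{v\to Y'}=0$, $\frac12|Y'|$, or $|Y'|$, respectively; a vertex $v$ is identified with $\{v\}$. When the target is a single vertex $x$, ''$Y$ is half-linked to $x$'' means $m_{Y\to x}=\frac12|Y|$.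 Switching: if the vertex $v$ is half-linked to $Y$ (i.e. $m_{v\to Y}=\frac12|Y|$), switching of $(v,Y)$ means replacing the $\frac12|Y|$ existing edges from $v$ to $Y$ by the $\frac12|Y|$ non-existing ones; if $m_{Y\to v}=\frac12|Y|$, switching of $(Y,v)$ means replacing the $\frac12|Y|$ existing edges from $Y$ to $v$ by the $\frac12|Y|$ non-existing ones. A switching is possible exactly when the respective half-linkedness condition holds. *)

(* Defs.v *)
From mathcomp Require Import all_boot all_order all_algebra.
From mathcomp Require Import mpoly.
Set Implicit Arguments.
Unset Strict Implicit.
Unset Printing Implicit Defensive.

Import GRing.Theory.
Local Open Scope ring_scope.

(* A digraph without parallel edges on the vertex set T is its edge relation
   e : rel T; it is simple when e is irreflexive (both e u v and e v u are
   allowed). *)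
Definition simple_digraph (T : finType) (e : rel T) : Prop := irreflexive e.

(* For simple e, the adjacency matrix of the complement is J - I - A. *)
Definition dcompl (T : finType) (e : rel T) : rel T :=
  [rel u v | (u != v) && ~~ e u v].

Section ZetaEquivalence.
Variables (R : comNzRingType) (T : finType) (e : rel T).

Definition adj_mx : 'M[R]_#|T| :=
  \matrix_(i, j) (e (enum_val i) (enum_val j))%:R.

Definition rowsum_mx n (A : 'M[R]_n) : 'M[R]_n :=
  diag_mx (\row_i \sum_j A i j).

Definition eta_det (x t_up t_down u_up u_down : R) : R :=
  \det (x%:M + t_up *: rowsum_mx adj_mx + t_down *: rowsum_mx adj_mx^T
        + u_up *: adj_mx + u_down *: adj_mx^T).

End ZetaEquivalence.

(* The five indeterminates x, t_up, t_down, u_up, u_down are 'X_0, ..., 'X_4. *)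
Definition eta (T : finType) (e : rel T) : {mpoly int[5]} :=
  eta_det e 'X_(inord 0) 'X_(inord 1) 'X_(inord 2) 'X_(inord 3) 'X_(inord 4).

Definition zeta_equivalent (T T' : finType) (e : rel T) (e' : rel T') : Prop :=
  [/\ simple_digraph e, simple_digraph e', #|T| = #|T'| & eta e = eta e'].

Section Linking.
Variables (T : finType) (e : rel T).
Implicit Types (x : T) (Y : {set T}).

Definition nedges Y Y' : nat :=
  #|[set z : T * T | [&& z.1 \in Y, z.2 \in Y' & e z.1 z.2]]|.

Definition unlinked Y Y' : bool :=
  [forall v in Y, nedges [set v] Y' == 0%N].

Definition half_linked Y Y' : bool :=
  [forall v in Y, (nedges [set v] Y').*2 == #|Y'|].

Definition fully_linked Y Y' : bool :=
  [forall v in Y, nedges [set v] Y' == #|Y'|].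

(* Half-linkedness of a set to a single vertex counts over the source: it is
   not [half_linked Y [set x]], which is unsatisfiable for nonempty Y. *)
Definition half_linked_to Y x : bool :=
  (nedges Y [set x]).*2 == #|Y|.

(* Edge counts between parts of Y are the same in the whole digraph and in the
   subdigraph induced by Y, so they are taken in the whole digraph. *)
Definition equitable_partition (r : nat) Y (P : 'I_r -> {set T}) : Prop :=
  [/\ forall i, P i != set0,
      forall i j, i != j -> [disjoint P i & P j],
      \bigcup_i P i = Y
    & forall i j v v', v \in P i -> v' \in P i ->
        nedges [set v] (P j) = nedges [set v'] (P j) /\
        nedges (P j) [set v] = nedges (P j) [set v']].

(* Only the values of phi on Y matter. *)
Definition induced_iso Y Y' (phi : T -> T) : Prop :=
  [/\ {in Y &, injective phi}, phi @: Y = Y'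
    & {in Y &, forall u v, e (phi u) (phi v) = e u v}].

(* All possible switchings of (x, Y) and (Y, x), for x in X and Y in the family
   B.  Provided the members of B are disjoint from X and from one another,
   different switchings act on disjoint sets of vertex pairs and do not
   influence each other's feasibility, so they can be done simultaneously. *)
Definition switch_all (X : {set T}) (B : {set {set T}}) : rel T :=
  fun u v =>
    if [exists Y in B, [&& u \in X, v \in Y & half_linked [set u] Y]]
       || [exists Y in B, [&& u \in Y, v \in X & half_linked_to Y v]]
    then ~~ e u v else e u v.

End Linking.

(* Main.v *)
(* Fix the pencil M = x + t D_out + t' D_in + w A + w' A^T + k J; the complement
   of G has a determinant of the same form, with t, t', w, w' negated and k = w + w'.
   We give an invertible Q, over the field of fractions, with Q M = M' Q.
   On W, Q is the Godsil-McKay matrix 2 J / n - 1 of each W_k, and on X it is the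
   identity.  On V_i u V_i', it exchanges the indicators of V_i and V_i', and acts
   on vectors of zero sum on both as the matrix ((a, b), (-b, a)), where
   a = 2 (w + w') and b = (t + t') delta_i.  On such vectors, M is the sum of
   ((d, w + w'), (w + w', d + (t + t') delta_i)), coming from the degrees and the
   matching v <-> Phi v, and of blocks ((C, N), (-N, C)).  The latter commute with Q
   (and vanish if delta_i <> delta_j), and the choice of a and b is what makes Q
   intertwine the former with the matrix in which the two degrees are exchanged.
   Finally, Q is invertible because a^2 + b^2 <> 0. *)
Require Import Defs.
From mathcomp Require Import all_boot all_order all_algebra.
From mathcomp Require Import mpoly.
From mathcomp Require Import fraction ring zify.
Set Implicit Arguments.
Unset Strict Implicit.
Unset Printing Implicit Defensive.
Import GRing.Theory.
Local Open Scope ring_scope.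

(** On vectors of zero sum, merely exchanging V_i and V_i' would also exchange the two degrees, but
    it would turn a block ((C, N), (-N, C)) into ((C, -N), (N, C)), while G and G' have the same
    edges off X. So Q should commute with these blocks, which suggests the matrix form ((a, b), (-b,
    a)) of a complex scalar. What remains is a condition on a matched pair with diagonal entries d,
    d' and matching weight s = w + w': it reads a (d' - d) = 2 b s, it fixes only the ratio a : b,
    and d' - d = (t + t') delta_i leads to the values chosen. This ratio varies with delta_i, so two
    blocks with different delta cannot share a scalar; hence the two cases in condition (8).

    The degrees of G' are never counted: once Q is known to intertwine the adjacency parts, applying
    that identity to the all-ones vector yields them. In-edges are treated by running the same
    argument on the converse digraph with the same Q. *)

Section Intertwining.
Variables (F : fieldType) (T : finType).
Hypothesis F_pchar0 : [pchar F] =i pred0.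
Variables (blk : T -> {set T}) (sg : T -> T).
Hypothesis blk_refl : forall a, a \in blk a.
Hypothesis blk_eq : forall a b, b \in blk a -> blk b = blk a.
Hypothesis sgK : involutive sg.
Hypothesis blk_sg : forall a b, b \in blk a -> sg b \in blk (sg a).

(** * Block averages and the operator Q *)

Definition avg (g : T -> F) (a : T) : F :=
  (\sum_(c in blk a) g c) / #|blk a|%:R.

(** The last term carries block means to the opposite block; the other two act on deviations from
    the mean, with [be] meant to be odd under [sg]. For [al = -1], [be = 0] and [sg a = a] this is
    [2 avg - g]; on a singleton block fixed by [sg] the deviations vanish and it is the identity,
    whatever the weights. *)
Definition Qop (al be : T -> F) (g : T -> F) (a : T) : F :=
  al a * (g a - avg g a) + be a * (g (sg a) - avg g (sg a)) + avg g (sg a).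

Lemma natF_neq0 n : (0 < n)%N -> n%:R != 0 :> F.
Proof. by move/pcharf0P: F_pchar0 => ->; rewrite lt0n. Qed.

Lemma card_blk_neq0 a : #|blk a|%:R != 0 :> F.
Proof. by rewrite natF_neq0 // card_gt0; apply/set0Pn; exists a. Qed.

Lemma blk_sym a b : (b \in blk a) = (a \in blk b).
Proof. by apply/idP/idP => H; rewrite (blk_eq H). Qed.

Lemma blk_sgE a b : (b \in blk (sg a)) = (sg b \in blk a).
Proof.
by apply/idP/idP => /blk_sg; rewrite sgK.
Qed.

Lemma card_blk_sg a : #|blk (sg a)| = #|blk a|.
Proof.
rewrite -(card_imset (blk a) (inv_inj sgK)); apply: eq_card => b.
rewrite blk_sgE; apply/idP/imsetP => [H|[c Hc ->]]; last by rewrite sgK.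
by exists (sg b); rewrite ?sgK.
Qed.

Lemma avg_blk g a b : b \in blk a -> avg g b = avg g a.
Proof. by move=> H; rewrite /avg (blk_eq H). Qed.

Lemma eq_avg g h a : {in blk a, g =1 h} -> avg g a = avg h a.
Proof. by move=> H; congr (_ / _); apply: eq_bigr. Qed.

Lemma avg_const g k a : {in blk a, forall c, g c = k} -> avg g a = k.
Proof.
move=> H; rewrite /avg (eq_bigr (fun=> k)) // sumr_const -[X in X / _]mulr_natr.
by rewrite mulfK // card_blk_neq0.
Qed.

Lemma avgD g h a : avg (fun c => g c + h c) a = avg g a + avg h a.
Proof. by rewrite /avg big_split mulrDl. Qed.

Lemma avgZ k g a : avg (fun c => k * g c) a = k * avg g a.
Proof. by rewrite /avg -mulr_sumr mulrA. Qed.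

Lemma avg_mul d g a : {in blk a, forall c, d c = d a} ->
  avg (fun c => d c * g c) a = d a * avg g a.
Proof. by move=> H; rewrite -avgZ; apply: eq_avg => c /H ->. Qed.

Lemma avg_sg g a : avg (fun c => g (sg c)) a = avg g (sg a).
Proof.
rewrite /avg card_blk_sg [in RHS](reindex_inj (inv_inj sgK)) /=.
by congr (_ / _); apply: eq_bigl => c; rewrite blk_sgE sgK.
Qed.

Lemma avg_avg g a : avg (avg g) a = avg g a.
Proof. by apply: avg_const => c /avg_blk ->. Qed.

Lemma avgB g h a : avg (fun c => g c - h c) a = avg g a - avg h a.
Proof. by rewrite /avg sumrB mulrBl. Qed.

(** [P] is a union of blocks, so each [g c] occurs once for every member of its block, with weight
    [1 / #|blk c|]. *)
Lemma sum_avg (P : pred T) g : (forall a, P a -> {in blk a, forall c, P c}) ->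
  \sum_(a | P a) avg g a = \sum_(a | P a) g a.
Proof.
move=> PP; rewrite /avg.
under eq_bigr => a Pa do rewrite mulr_suml.
rewrite (exchange_big_dep P) /=; last by move=> a c /PP; apply.
apply: eq_bigr => c Pc.
rewrite (eq_bigl (mem (blk c))) => [|a /=].
  rewrite (eq_bigr (fun=> g c / #|blk c|%:R)) => [|a /blk_eq -> //].
  by rewrite sumr_const -[LHS]mulr_natr divfK // card_blk_neq0.
rewrite blk_sym; case: (boolP (a \in blk c)) => H; rewrite ?andbF ?andbT //.
exact: PP H.
Qed.

Lemma QopD al be g h a :
  Qop al be (fun c => g c + h c) a = Qop al be g a + Qop al be h a.
Proof. by rewrite /Qop !avgD; ring. Qed.

Lemma QopZ al be k g a : Qop al be (fun c => k * g c) a = k * Qop al be g a.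
Proof. by rewrite /Qop !avgZ; ring. Qed.

Lemma eq_Qop al be g h a : g =1 h -> Qop al be g a = Qop al be h a.
Proof. by move=> H; rewrite /Qop !H !(@eq_avg g h) // => ? _. Qed.

Lemma Qop_const al be k a : Qop al be (fun=> k) a = k.
Proof. by rewrite /Qop !(@avg_const (fun=> k) k) //; ring. Qed.

Definition Qker al be (a b : T) := Qop al be (fun c => (c == b)%:R) a.

Lemma sum_delta (g : T -> F) a : \sum_c (a == c)%:R * g c = g a.
Proof.
rewrite (bigD1 a) //= eqxx mul1r big1 ?addr0 // => c /negPf.
by rewrite eq_sym => ->; rewrite mul0r.
Qed.

Lemma avg_delta a b : avg (fun c => (c == b)%:R) a = (b \in blk a)%:R / #|blk a|%:R.
Proof.
congr (_ / _); case: (boolP (b \in blk a)) => H.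
  rewrite (bigD1 b) //= eqxx big1 ?addr0 // => c /andP[_ /negPf -> //].
by rewrite big1 // => c Hc; case: eqP => // E; rewrite -E Hc in H.
Qed.

Lemma Qker_row al be g a : \sum_c Qker al be a c * g c = Qop al be g a.
Proof.
have E b : \sum_c avg (fun c' => (c' == c)%:R) b * g c = avg g b.
  under eq_bigr => c _ do rewrite avg_delta mulrAC.
  rewrite -mulr_suml; congr (_ / _); rewrite [RHS]big_mkcond; apply: eq_bigr => c _.
  by case: ifP; rewrite ?mul1r ?mul0r.
rewrite /Qker /Qop.
under eq_bigr => c _ do rewrite 2!mulrDl -(mulrA (al a)) -(mulrA (be a)) !mulrBl.
by rewrite !big_split /= -!mulr_sumr !sumrB !E !sum_delta.
Qed.

Variables (al be : T -> F).
Hypothesis al_blk : forall a b, b \in blk a -> al b = al a.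
Hypothesis be_blk : forall a b, b \in blk a -> be b = be a.
Hypothesis al_sg : forall a, al (sg a) = al a.
Hypothesis be_sg : forall a, be (sg a) = - be a.

Let nbe a := - be a.

(** The [al] part and the mean part are symmetric. The [be] part lives where [sg a] and [b] share a
    block, and there [be b = - be a], so transposing flips its sign. *)
Lemma Qker_tr a b : Qker al be a b = Qker al nbe b a.
Proof.
rewrite /Qker /Qop !avg_delta /nbe !card_blk_sg !blk_sgE.
have -> : (sg a \in blk b) = (sg b \in blk a) by rewrite blk_sym blk_sgE.
have -> : (sg b == a) = (sg a == b) by rewrite (can2_eq sgK sgK) eq_sym.
rewrite (blk_sym b a) (eq_sym b a).
have H1 : al a * ((a == b)%:R - (b \in blk a)%:R / #|blk a|%:R)
   = al b * ((a == b)%:R - (b \in blk a)%:R / #|blk b|%:R).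
  case: (boolP (b \in blk a)) => Hb; first by rewrite (al_blk Hb) (blk_eq Hb).
  by case: eqP => E; [rewrite E blk_refl in Hb | rewrite !mul0r subr0 !mulr0].
have H2 : be a * ((sg a == b)%:R - (sg b \in blk a)%:R / #|blk a|%:R)
   = - be b * ((sg a == b)%:R - (sg b \in blk a)%:R / #|blk b|%:R).
  case: (boolP (sg b \in blk a)) => Hb.
    by rewrite -(be_blk Hb) -(blk_eq Hb) be_sg card_blk_sg.
  case: eqP => E; first by rewrite -E sgK blk_refl in Hb.
  by rewrite !mul0r subr0 !mulr0.
have H3 : (sg b \in blk a)%:R / #|blk a|%:R = (sg b \in blk a)%:R / #|blk b|%:R :> F.
  case: (boolP (sg b \in blk a)) => Hb; last by rewrite !mul0r.
  by rewrite -(blk_eq Hb) card_blk_sg.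
by rewrite H1 H2 H3.
Qed.

Lemma Qker_col h b : \sum_c h c * Qker al be c b = Qop al nbe h b.
Proof.
by rewrite -Qker_row; apply: eq_bigr => c _; rewrite Qker_tr mulrC.
Qed.

Hypothesis al_be_neq0 : forall a, al a ^+ 2 + be a ^+ 2 != 0.

(** Averaging the equation over a block kills the deviations and shows that all means of [g] vanish.
    What is left at [a] and [sg a] is a 2 x 2 linear system of determinant
    [al a ^+ 2 + be a ^+ 2]. *)
Lemma Qop_inj g : (forall a, Qop al nbe g a = 0) -> forall a, g a = 0.
Proof.
move=> H.
have A a : avg g a = 0.
  have /= := avg_const (k := 0) (fun c (_ : c \in blk (sg a)) => H c).
  rewrite /Qop avgD avgD (@avg_mul al) => [|c]; last exact: al_blk.
  rewrite (@avg_mul nbe) => [|c Hc]; last by rewrite /nbe (be_blk Hc).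
  by rewrite !avgB (avg_sg g) (avg_sg (avg g)) !avg_avg sgK !subrr !mulr0 !add0r.
move=> a; have := H a; have := H (sg a).
rewrite /Qop !A !subr0 !addr0 /nbe al_sg be_sg sgK opprK => E1 E2.
have : (al a ^+ 2 + be a ^+ 2) * g a = 0.
  transitivity (al a * (al a * g a + - be a * g (sg a))
     + be a * (al a * g (sg a) + be a * g a)); first by ring.
  by rewrite E1 E2 !mulr0 addr0.
by move/eqP; rewrite mulf_eq0 (negPf (al_be_neq0 a)) => /eqP.
Qed.

(* This is Q m = m' Q, where Q has entries [Qker al be]: by [Qker_col], a
   multiplication by Q on the right is [Qop] with the opposite weight. *)
Definition intertwined (m m' : T -> T -> F) : Prop :=
  forall a b, Qop al be (m^~ b) a = Qop al nbe (m' a) b.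

(** * Determinants and row sums of intertwined kernels *)

Definition mx_of (m : T -> T -> F) : 'M[F]_#|T| :=
  \matrix_(i, j) m (enum_val i) (enum_val j).

Lemma sum_enum_val (g : T -> F) : \sum_(i < #|T|) g (enum_val i) = \sum_c g c.
Proof. rewrite [RHS](reindex (fun i : 'I_#|T| => enum_val i)) //=.
exact/onW_bij/enum_val_bij. Qed.

Lemma mx_ofM m1 m2 : mx_of m1 *m mx_of m2
  = mx_of (fun a b => \sum_c m1 a c * m2 c b).
Proof.
apply/matrixP => i j; rewrite !mxE -sum_enum_val.
by apply: eq_bigr => k _; rewrite !mxE.
Qed.

Lemma Qker_det_neq0 : \det (mx_of (Qker al be)) != 0.
Proof.
apply/negP => /det0P [v v0 vQ]; case/negP: v0; apply/eqP/rowP => k.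
rewrite mxE -(enum_valK k).
apply: (Qop_inj (g := fun a => v 0 (enum_rank a))) => b.
have /rowP /(_ (enum_rank b)) := vQ; rewrite !mxE => <-.
rewrite -Qker_col -sum_enum_val.
by apply: eq_bigr => i _; rewrite !mxE enum_valK enum_rankK.
Qed.

Lemma intertwined_det m m' : intertwined m m' ->
  \det (mx_of m) = \det (mx_of m').
Proof.
move=> H; apply: (mulfI Qker_det_neq0); rewrite [RHS]mulrC -!det_mulmx !mx_ofM.
congr (\det _); apply/matrixP => i j; rewrite !mxE Qker_row Qker_col; exact: H.
Qed.

Lemma intertwinedD m1 m1' m2 m2' : intertwined m1 m1' -> intertwined m2 m2' ->
  intertwined (fun a b => m1 a b + m2 a b) (fun a b => m1' a b + m2' a b).
Proof. by move=> H1 H2 a b; rewrite !QopD H1 H2. Qed.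

Lemma intertwinedZ k m m' : intertwined m m' ->
  intertwined (fun a b => k * m a b) (fun a b => k * m' a b).
Proof. by move=> H a b; rewrite !QopZ H. Qed.

Lemma intertwined_const k : intertwined (fun _ _ => k) (fun _ _ => k).
Proof. by move=> a b; rewrite !Qop_const. Qed.

Lemma Qker_sum a : \sum_c Qker al be a c = 1.
Proof.
rewrite -[RHS](Qop_const al be 1 a) -Qker_row.
by apply: eq_bigr => c _; rewrite mulr1.
Qed.

(* Apply Q m = m' Q to the all-ones vector, which Q fixes. *)
Lemma intertwined_rowsum m m' : intertwined m m' ->
  (forall a b, b \in blk a -> \sum_c m b c = \sum_c m a c) ->
  forall a, \sum_c m' a c = \sum_c m (sg a) c.
Proof.
move=> H C a; have -> : \sum_c m (sg a) c = Qop al be (fun b => \sum_c m b c) a.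
  rewrite /Qop !(avg_const (fun c Hc => C _ c Hc)); ring.
rewrite -Qker_row; under [RHS]eq_bigr => b _ do rewrite mulr_sumr.
rewrite exchange_big /=; under [RHS]eq_bigr => b _ do rewrite Qker_row H -Qker_col.
rewrite exchange_big /=; apply: eq_bigr => b _.
by rewrite -mulr_sumr Qker_sum mulr1.
Qed.

(** Means are exchanged together with the diagonal entries, so they match. On deviations the claim
    is ((a, b), (-b, a)) ((d, s), (s, d')) = ((d', s), (s, d)) ((a, b), (-b, a)): the off-diagonal
    entries agree identically, and both diagonal ones amount to a (d' - d) = 2 b s. *)
Lemma intertwined_diag_swap (d s : T -> F) :
  (forall a b, b \in blk a -> d b = d a) ->
  (forall a b, b \in blk a -> s b = s a) ->
  (forall a, s (sg a) = s a) ->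
  (forall a, al a * (d (sg a) - d a) = be a * s a *+ 2) ->
  intertwined (fun a b => d a * (a == b)%:R + s a * (sg a == b)%:R)
              (fun a b => d (sg a) * (a == b)%:R + s a * (sg a == b)%:R).
Proof.
move=> dB sB sS ds a b; set g := fun c => (c == b)%:R : F.
have -> : Qop al nbe (fun b0 => d (sg a) * (a == b0)%:R + s a * (sg a == b0)%:R) b
   = d (sg a) * Qop al be g a + s a * Qop al be g (sg a).
  rewrite -Qker_col; under eq_bigr => c _ do rewrite mulrDl -!mulrA.
  by rewrite big_split /= -!mulr_sumr !sum_delta.
have A c : avg (fun c => d c * (c == b)%:R + s c * (sg c == b)%:R) c
  = d c * avg g c + s c * avg g (sg c).
  rewrite avgD (@avg_mul d) => [|e]; last exact: dB.
  rewrite (@avg_mul s) => [|e]; last exact: sB.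
  by rewrite (avg_sg g).
rewrite /Qop !A -/(g a) -/(g (sg a)) sgK al_sg be_sg sS -/(g a).
have D : al a * d (sg a) = al a * d a + be a * s a *+ 2 by rewrite -ds; ring.
apply/eqP; rewrite -subr_eq0; apply/eqP.
transitivity ((al a * d a + be a * s a *+ 2 - al a * d (sg a)) * (g a - avg g a)).
  ring.
by rewrite D subrr mul0r.
Qed.

(** * Switching edges between X and its complement *)

Variables X U : {set T}.
Hypothesis X_blk : forall a, a \in X -> blk a = [set a].
Hypothesis X_sg : forall a, a \in X -> sg a = a.
Hypothesis offU : forall a, a \notin U -> [/\ sg a = a, al a = -1 & be a = 0].

(* For u outside of U, where [sg u = u], the condition is b' = 2 avg - b, that
   is Godsil-McKay switching; for u in U, it exchanges u and [sg u]. *)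
Definition crossing_switch (b b' : T -> T -> F) : Prop :=
  forall u x, u \notin X -> x \in X ->
  b' u x = avg (b^~ x) (sg u) - (b u x - avg (b^~ x) u) /\
  (u \in U -> b u x = avg (b^~ x) u).

(** Outside X the kernel is not changed, so it must commute with Q. The conditions compare the two
    products term by term: the first two match the means, the third the [be] terms, and the fourth
    the [al] terms, forcing a constant block wherever [al] differs. *)
Definition inner_compatible (b : T -> T -> F) : Prop :=
  forall u v, u \notin X -> v \notin X ->
  [/\ avg (b u) v = avg (b^~ v) u,
      avg (b^~ (sg v)) (sg u) = avg (b^~ v) u,
      be u * (b (sg u) v - avg (b^~ v) (sg u)) =
        - be v * (b u (sg v) - avg (b^~ (sg v)) u)
    & (al u - al v) * (b u v - avg (b^~ v) u) = 0].

Lemma blk_notX a c : a \notin X -> c \in blk a -> c \notin X.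
Proof.
move=> aX ca; apply/negP => cX; case/negP: aX.
by move: ca; rewrite blk_sym (X_blk cX) inE => /eqP ->.
Qed.

Lemma sg_notX a : a \notin X -> sg a \notin X.
Proof. by apply: contra => H; rewrite -(sgK a) (X_sg H). Qed.

Lemma avgX g x : x \in X -> avg g x = g x.
Proof.
by move=> xX; apply: avg_const => c; rewrite (X_blk xX) inE => /eqP ->.
Qed.

Lemma QopX be1 g x : x \in X -> Qop al be1 g x = g x.
Proof. by move=> xX; rewrite /Qop X_sg // avgX //; ring. Qed.

Lemma crossing_Qop b b' u x : crossing_switch b b' -> u \notin X -> x \in X ->
  Qop al be (b^~ x) u = b' u x.
Proof.
move=> C uX xX; have [-> Hu] := C u x uX xX; rewrite /Qop.
case: (boolP (u \in U)) => [uU|/offU [-> -> ->]]; last by ring.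
rewrite Hu //; case: (boolP (sg u \in U)) => [sU|/offU [E _ _]].
  by have [_ ->] := C _ x (sg_notX uX) xX; rewrite // !subrr !mulr0 !add0r subr0.
rewrite sgK in E; rewrite -E Hu //; ring.
Qed.

(** Switching is an involution on these columns. The sign of [be] is immaterial, since on U the
    columns are constant on blocks and have no deviation for [be] to act on. *)
Lemma crossing_Qop_inv b b' u x : crossing_switch b b' -> u \notin X -> x \in X ->
  Qop al nbe (b'^~ x) u = b u x.
Proof.
move=> C uX xX.
have A c : c \notin X -> avg (b'^~ x) c = avg (b^~ x) (sg c).
  move=> cX; rewrite (@eq_avg _ (fun c => avg (b^~ x) (sg c) - (b c x - avg (b^~ x) c))).
    by rewrite !avgB (avg_sg (avg _)) !avg_avg; ring.
  by move=> e /(blk_notX cX) eX; have [] := C e x eX xX.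
have [E Hu] := C u x uX xX; have [Es Hs] := C _ x (sg_notX uX) xX.
rewrite /Qop !A ?sg_notX // E Es sgK /nbe.
case: (boolP (u \in U)) => [uU|/offU [-> -> ->]]; last by ring.
rewrite Hu //; case: (boolP (sg u \in U)) => [sU|/offU [E1 _ _]].
  by rewrite Hs //; ring.
rewrite sgK in E1; rewrite -E1 Hu //; ring.
Qed.

(** As Q is the identity on X, the four blocks cut out by X separate: nothing changes inside X, the
    columns of X ask that Q perform the switching, the rows of X that its transpose undo it, and the
    rest is commutation. *)
Lemma intertwined_switch b b' :
  (forall u v, (u \in X) = (v \in X) -> b' u v = b u v) ->
  crossing_switch b b' ->
  crossing_switch (fun u v => b v u) (fun u v => b' v u) ->
  inner_compatible b ->
  intertwined b b'.
Proof.
move=> E C1 C2 I u v.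
case: (boolP (u \in X)) (boolP (v \in X)) => [uX|uX] [vX|vX].
- by rewrite !QopX // E // uX vX.
- rewrite QopX //; symmetry.
  exact: (@crossing_Qop_inv (fun u v => b v u) (fun u v => b' v u)).
- by rewrite (QopX _ _ vX) (crossing_Qop C1).
have sv := sg_notX vX; have su := sg_notX uX.
have Eb w : w \notin X -> b' u w = b u w.
  by move=> wX; rewrite E // (negPf uX) (negPf wX).
have Ea w : w \notin X -> avg (b' u) w = avg (b u) w.
  by move=> wX; apply: eq_avg => c /(blk_notX wX); exact: Eb.
rewrite /Qop !Ea // !Eb //.
have [-> M1 Z A] := I u v uX vX; have [-> M2 _ _] := I u _ uX sv.
rewrite sgK in M2; rewrite Z M2 /nbe; apply/eqP; rewrite -subr_eq0; apply/eqP.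
transitivity ((al u - al v) * (b u v - avg (b^~ v) u)); first by ring.
exact: A.
Qed.

Lemma inner_compatible_tr b :
  inner_compatible b -> inner_compatible (fun u v => b v u).
Proof.
move=> I u v uX vX; have su := sg_notX uX; have sv := sg_notX vX.
have [E1 E2 E3 E4] := I v u vX uX; have [F1 F2 _ _] := I _ _ sv su.
have [G1 G2 _ _] := I _ _ sv uX; have [H1 H2 _ _] := I _ _ vX su.
split; rewrite ?E1 ?F1 ?G1 ?H1 //.
  by rewrite mulNr E3 mulNr opprK.
by rewrite -(opprB (al v)) mulNr E4 oppr0.
Qed.

(** Each entry of a row may be replaced by its mean over the columns of a block without changing the
    row sum. By compatibility this equals the mean over the rows of a block, which depends on the
    row only through its block and is invariant under applying [sg] to both indices. *)
Lemma inner_rowsum b : inner_compatible b ->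
  forall a, a \notin X -> forall c, c \in blk a \/ c = sg a ->
  \sum_(v | v \notin X) b c v = \sum_(v | v \notin X) b a v.
Proof.
move=> I a aX c Hc.
have PB u : u \notin X -> {in blk u, forall e, e \notin X}.
  by move=> uX e; exact: blk_notX.
have R u : u \notin X -> \sum_(v | v \notin X) b u v
  = \sum_(v | v \notin X) avg (b^~ v) u.
  move=> uX; rewrite -(sum_avg _ PB); apply: eq_bigr => v vX.
  by have [] := I u v uX vX.
have cX : c \notin X by case: Hc => [/(blk_notX aX)|->] //; exact: sg_notX.
rewrite !R //; case: Hc => [Hc|->].
  by apply: eq_bigr => v _; exact: avg_blk.
rewrite (reindex_inj (inv_inj sgK)) /=.
rewrite (eq_bigl (fun v => v \notin X)) => [|v /=].
  by apply: eq_bigr => v vX; have [] := I a v aX vX.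
by apply/idP/idP => /sg_notX //; rewrite sgK.
Qed.

(** Both sides are the mean of [b] over [P] x [Q]. *)
Lemma double_count (P Q : {set T}) (b : T -> T -> F) r k :
  (0 < #|P|)%N -> (0 < #|Q|)%N ->
  {in P, forall a, \sum_(c in Q) b a c = r} ->
  {in Q, forall c, \sum_(a in P) b a c = k} ->
  r / #|Q|%:R = k / #|P|%:R.
Proof.
move=> /natF_neq0 P0 /natF_neq0 Q0 Hr Hk.
have E : #|P|%:R * r = #|Q|%:R * k.
  rewrite !mulr_natl -!sumr_const -(eq_bigr _ Hr) -(eq_bigr _ Hk).
  exact: exchange_big.
apply: (mulfI P0); rewrite [RHS]mulrC divfK //.
by rewrite mulrA E mulrAC divff // mul1r.
Qed.

(** * The matching on U and the determinant of the pencil *)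

Hypothesis U_blk : forall a c, c \in blk a -> (c \in U) = (a \in U).
Hypothesis UX : [disjoint U & X].

Lemma sg_U a : (sg a \in U) = (a \in U).
Proof.
apply/idP/idP; apply: contraTT => aU; have [E _ _] := offU aU; first by rewrite E.
by move: aU; rewrite -{1}E sgK.
Qed.

(** This part of the adjacency matrix is split off because ((0, 1), (1, 0)) does not commute with
    ((a, b), (-b, a)) when b is nonzero; it is handled jointly with the degrees. *)
Definition matching (a b : T) : F := (a \in U)%:R * (sg a == b)%:R.

Lemma matching_sym a b : matching a b = matching b a.
Proof.
rewrite /matching (can2_eq sgK sgK) eq_sym.
by case: eqP => [<-|]; rewrite ?mulr0 // sg_U.
Qed.

Lemma matching_rowsum a : \sum_c matching a c = (a \in U)%:R.
Proof.
rewrite /matching -mulr_sumr -[RHS]mulr1; congr (_ * _).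
by rewrite -[RHS](sum_delta (fun=> 1) (sg a)); apply: eq_bigr => c _; rewrite mulr1.
Qed.

Lemma matchingX a x : a \notin X -> x \in X -> matching a x = 0.
Proof.
move=> aX xX; rewrite /matching; case: eqP => E; last by rewrite mulr0.
by have := sg_notX aX; rewrite E xX.
Qed.

Definition pencil (A : T -> T -> F) (x t t' w w' k : F) (a b : T) : F :=
  (x + t * (\sum_c A a c) + t' * (\sum_c A c a)) * (a == b)%:R
  + w * A a b + w' * A b a + k.

Definition out_regular (A : T -> T -> F) (dl : T -> F) : Prop :=
  (forall a c, a \notin X -> c \in blk a ->
     \sum_(x in X) A c x = \sum_(x in X) A a x) /\
  (forall a, a \in U -> \sum_(x in X) A (sg a) x - \sum_(x in X) A a x = dl a).

(** The matching adds 1 to every row sum in U on both sides, so the row sums of the remainder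
    decide. By [inner_rowsum], rows [a] and [sg a] agree outside X, and their degrees differ only
    through X. *)
Lemma intertwined_outdegree A A' dl :
  intertwined (fun a b => A a b - matching a b) (fun a b => A' a b - matching a b) ->
  inner_compatible (fun a b => A a b - matching a b) ->
  out_regular A dl ->
  [/\ forall a b, b \in blk a -> \sum_c A b c = \sum_c A a c,
      forall a, \sum_c A' a c = \sum_c A (sg a) c
    & forall a, a \in U -> \sum_c A (sg a) c - \sum_c A a c = dl a].
Proof.
move=> IT IC [R1 R2]; set B := fun a b => A a b - matching a b in IT IC.
have split_B a : \sum_c A a c = \sum_c B a c + (a \in U)%:R.
  by rewrite /B sumrB matching_rowsum subrK.
have BX a : a \notin X -> \sum_(x in X) B a x = \sum_(x in X) A a x.
  by move=> aX; apply: eq_bigr => x xX; rewrite /B matchingX // subr0.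
have sum_X (g : T -> F) : \sum_c g c = \sum_(c in X) g c + \sum_(c | c \notin X) g c.
  by rewrite [LHS](bigID (mem X)).
have C a b : b \in blk a -> \sum_c B b c = \sum_c B a c.
  case: (boolP (a \in X)) => aX ba.
    by move: ba; rewrite X_blk // inE => /eqP ->.
  rewrite !sum_X !BX // ?(blk_notX aX ba) // (R1 a b) //.
  by rewrite (inner_rowsum IC aX (or_introl ba)).
split=> [a b ba|a|a aU].
- by rewrite !split_B (C _ _ ba) (U_blk ba).
- rewrite split_B -(intertwined_rowsum IT C) sg_U.
  by rewrite sumrB matching_rowsum subrK.
have aX : a \notin X by rewrite (disjointFr UX).
rewrite !split_B sg_U !sum_X !BX ?sg_notX //.
rewrite (inner_rowsum IC aX (or_intror erefl)) -(R2 a aU); ring.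
Qed.

Lemma pencil_det A A' dl x t t' w w' k :
  let B := fun a b => A a b - matching a b in
  let B' := fun a b => A' a b - matching a b in
  (forall u v, (u \in X) = (v \in X) -> A' u v = A u v) ->
  crossing_switch B B' ->
  crossing_switch (fun u v => B v u) (fun u v => B' v u) ->
  inner_compatible B ->
  out_regular A dl -> out_regular (fun u v => A v u) dl ->
  {in U, forall a, al a = 2 * (w + w') /\ be a = (t + t') * dl a} ->
  \det (mx_of (pencil A x t t' w w' k)) = \det (mx_of (pencil A' x t t' w w' k)).
Proof.
move=> B B' E C1 C2 I R1 R2 P; have It := inner_compatible_tr I.
have EB u v : (u \in X) = (v \in X) -> B' u v = B u v.
  by move=> uv; rewrite /B' /B E.
have T1 : intertwined B B' by exact: intertwined_switch.
have T2 : intertwined (fun u v => B v u) (fun u v => B' v u).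
  by apply: intertwined_switch => // u v uv; rewrite EB.
have [D1 D2 D3] := intertwined_outdegree T1 I R1.
have T2' : intertwined (fun a b => A b a - matching a b) (fun a b => A' b a - matching a b).
  move=> a b; have := T2 a b; rewrite /B /B'.
  rewrite (@eq_Qop _ _ _ (fun c => A b c - matching c b)) => [->|c].
    by apply: eq_Qop => c; rewrite matching_sym.
  by rewrite matching_sym.
have I2' : inner_compatible (fun a b => A b a - matching a b).
  move=> u v uX vX; have := It u v uX vX; rewrite /B.
  have H a : (fun c => A c a - matching c a) =1 (fun c => A c a - matching a c).
    by move=> c; rewrite matching_sym.
  have H' a : (fun c => A a c - matching a c) =1 (fun c => A a c - matching c a).
    by move=> c; rewrite matching_sym.
  have AH a c := @eq_avg _ _ c (in1W (H a)).
  have AH' a c := @eq_avg _ _ c (in1W (H' a)).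
  by rewrite !AH !AH' !(matching_sym v) !(matching_sym (sg v)).
have [G1 G2 G3] := intertwined_outdegree T2' I2' R2.
pose d a := x + t * (\sum_c A a c) + t' * (\sum_c A c a).
(* The matching is symmetric, so it enters once through A with weight [w] and once through its
   transpose with weight [w']. The pencil is then the diagonal plus this matching term, plus [w] and
   [w'] times the matching-free parts, plus the constant [k]. *)
pose s a := (w + w') * (a \in U)%:R.
have TD : intertwined (fun a b => d a * (a == b)%:R + s a * (sg a == b)%:R)
                      (fun a b => d (sg a) * (a == b)%:R + s a * (sg a == b)%:R).
  apply: intertwined_diag_swap => [a b ab|a b ab|a|a].
  - by rewrite /d (D1 _ _ ab) (G1 _ _ ab).
  - by rewrite /s (U_blk ab).
  - by rewrite /s sg_U.
  rewrite /d /s; case: (boolP (a \in U)) => aU; last first.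
    by have [-> _ ->] := offU aU; ring.
  have [-> ->] := P a aU.
  transitivity (2 * (w + w') * (t * (\sum_i A (sg a) i - \sum_i A a i)
     + t' * (\sum_i A i (sg a) - \sum_i A i a))); first by ring.
  rewrite D3 // G3 //= mulr1; ring.
have H := intertwinedD (intertwinedD TD
  (intertwinedD (intertwinedZ w T1) (intertwinedZ w' T2))) (intertwined_const k).
apply: intertwined_det => a b; apply: etrans (etrans (H a b) _).
  apply: eq_Qop => c; rewrite /pencil /d /s /B (matching_sym b c) /matching; ring.
apply: eq_Qop => c.
rewrite /pencil /d /s /B' (matching_sym c a) /matching D2 G2; ring.
Qed.

End Intertwining.

(** * Edge counts as sums of Booleans *)

Section EdgeCounts.
Variables (T : finType) (e : rel T).
Implicit Types (u v : T) (Y : {set T}).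

Definition converse : rel T := fun u v => e v u.

Lemma nedges_from u Y : nedges e [set u] Y = (\sum_(y in Y) e u y)%N.
Proof.
rewrite /nedges -sum1_card (eq_bigl (fun z => (z.1 == u) && ((z.2 \in Y) && e z.1 z.2))).
  rewrite -(pair_big_dep (pred1 u) (fun x y => (y \in Y) && e x y) (fun _ _ => 1%N)) /=.
  by rewrite big_pred1_eq big_mkcondr; apply: eq_bigr => y _; case: (e u y).
by move=> z; rewrite !inE.
Qed.

Lemma nedges_to u Y : nedges e Y [set u] = (\sum_(y in Y) e y u)%N.
Proof.
rewrite /nedges -sum1_card (eq_bigl (fun z => ((z.1 \in Y) && ((z.2 == u) && e z.1 z.2)))).
  rewrite -(pair_big_dep (mem Y) (fun x y => (y == u) && e x y) (fun _ _ => 1%N)) /=.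
  apply: eq_bigr => y _; rewrite big_mkcondr big_pred1_eq; by case: (e y u).
by move=> z; rewrite !inE.
Qed.

Lemma sum_edges_eq0 Y (f : T -> bool) :
  (\sum_(y in Y) f y)%N = 0%N -> {in Y, forall y, f y = false}.
Proof.
by move=> /eqP; rewrite sum_nat_eq0 => /forall_inP H y /H; case: (f y).
Qed.

Lemma sum_edges_full Y (f : T -> bool) :
  (\sum_(y in Y) f y)%N = #|Y| -> {in Y, forall y, f y}.
Proof.
move=> H; have : (\sum_(y in Y) ~~ f y)%N = 0%N.
  apply/eqP; rewrite -(eqn_add2l (\sum_(y in Y) f y)%N) addn0 -big_split /=.
  by rewrite H -sum1_card; apply/eqP; apply: eq_bigr => y _; case: (f y).
by move/sum_edges_eq0 => K y /K; case: (f y).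
Qed.

Lemma unlinkedP Y Y' u v : unlinked e Y Y' -> u \in Y -> v \in Y' -> e u v = false.
Proof.
move=> /forall_inP H uY vY; have /eqP := H u uY; rewrite nedges_from.
by move/sum_edges_eq0; apply.
Qed.

Lemma fully_linkedP Y Y' u v : fully_linked e Y Y' -> u \in Y -> v \in Y' -> e u v.
Proof.
move=> /forall_inP H uY vY; have /eqP := H u uY; rewrite nedges_from.
by move/sum_edges_full; apply.
Qed.

Lemma half_linkedP Y Y' u : half_linked e Y Y' -> u \in Y ->
  (\sum_(y in Y') e u y)%N.*2 = #|Y'|.
Proof. by move=> /forall_inP H uY; have /eqP := H u uY; rewrite nedges_from. Qed.

Lemma half_linked_toE Y u : half_linked_to e Y u = ((\sum_(y in Y) e y u)%N.*2 == #|Y|).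
Proof. by rewrite /half_linked_to nedges_to. Qed.

Lemma half_linked1E Y u : half_linked e [set u] Y = ((\sum_(y in Y) e u y)%N.*2 == #|Y|).
Proof.
apply/forall_inP/idP => [/(_ u)|H v]; rewrite inE ?eqxx nedges_from; first exact.
by move/eqP => ->.
Qed.

End EdgeCounts.

(** * The switched digraph *)

Section Switchings.
Variables (T : finType) (e : rel T).

(** Reversal exchanges the two kinds of switchings, so facts about edges into X yield those about
    edges out of X. *)
Lemma switch_all_converse (X : {set T}) B u v :
  switch_all (converse e) X B u v = switch_all e X B v u.
Proof.
rewrite /switch_all orbC.
congr (if _ || _ then _ else _).
  by apply: eq_existsb => Y; congr (_ && _); rewrite half_linked_toE half_linked1E andbCA.
by apply: eq_existsb => Y; congr (_ && _); rewrite half_linked_toE half_linked1E andbCA.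
Qed.

Variables (X : {set T}) (B : {set {set T}}).
Hypothesis BX : forall Y, Y \in B -> [disjoint Y & X].

Lemma switch_all_same u v : (u \in X) = (v \in X) -> switch_all e X B u v = e u v.
Proof.
move=> uv; rewrite /switch_all; case: ifP => // /orP [] /exists_inP [Y YB /and3P [a b _]].
  by rewrite uv (disjointFr (BX YB) b) in a.
by rewrite -uv (disjointFr (BX YB) a) in b.
Qed.

Lemma switch_all_to Y u x : Y \in B -> (forall Z, Z \in B -> u \in Z -> Z = Y) ->
  u \in Y -> x \in X ->
  switch_all e X B u x = (if half_linked_to e Y x then ~~ e u x else e u x).
Proof.
move=> YB uniqY uY xX; rewrite /switch_all; congr (if _ then _ else _).
apply/orP/idP => [[] /exists_inP [Z ZB /and3P [a b c]]|H].
- by rewrite (disjointFr (BX YB) uY) in a.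
- by rewrite -(uniqY Z).
by right; apply/exists_inP; exists Y => //; rewrite uY xX.
Qed.

End Switchings.

(** * Blocks, involution and weights of the given vertex partition *)

Section Blocks.
Variables (T : finType) (V V' W X : {set T}) (Phi : T -> T) (p q : nat).
Variables (VP VP' : 'I_p -> {set T}) (WP : 'I_q -> {set T}).
Hypothesis cover : V :|: V' :|: W :|: X = [set: T].
Hypothesis disj : [/\ [disjoint V & V'], [disjoint V & W], [disjoint V & X],
     [disjoint V' & W] & [disjoint V' & X] /\ [disjoint W & X]].
Hypothesis Phi_inj : {in V &, injective Phi}.
Hypothesis Phi_V : Phi @: V = V'.
Hypothesis VP_disj : forall i j, i != j -> [disjoint VP i & VP j].
Hypothesis VP_cover : \bigcup_i VP i = V.
Hypothesis VP'_def : forall i, VP' i = Phi @: VP i.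
Hypothesis WP_disj : forall i j, i != j -> [disjoint WP i & WP j].
Hypothesis WP_cover : \bigcup_k WP k = W.

(** Vertices of V and V' are written [side s v] with [v] in V, so that exchanging the two copies is
    negating [s] and both copies are treated by one argument. *)
Definition side (s : bool) (v : T) : T := if s then Phi v else v.

(* The involution v <-> Phi v on the union of V and V', identity elsewhere. *)
Definition swap (a : T) : T :=
  if a \in V then Phi a else
  if a \in V' then odflt a [pick v in V | Phi v == a] else a.

Definition block (a : T) : {set T} :=
  if [pick i | a \in VP i] is Some i then VP i else
  if [pick i | a \in VP' i] is Some i then VP' i else
  if [pick k | a \in WP k] is Some k then WP k else [set a].

(** The sign on the V' side makes the weight odd under [swap]; it is the -b in ((a, b), (-b, a)). *)
Definition block_weight (F : fieldType) (f : 'I_p -> F) (a : T) : F :=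
  if [pick i | a \in VP i] is Some i then f i else
  if [pick i | a \in VP' i] is Some i then - f i else 0.

Definition scale_weight (F : fieldType) (al : F) (a : T) : F :=
  if a \in V :|: V' then al else -1.

Lemma VP_V i v : v \in VP i -> v \in V.
Proof. by move=> vi; rewrite -VP_cover; apply/bigcupP; exists i. Qed.

Lemma WP_W k w : w \in WP k -> w \in W.
Proof. by move=> wk; rewrite -WP_cover; apply/bigcupP; exists k. Qed.

Lemma disjoint_family_inj r (P : 'I_r -> {set T}) i j v :
  (forall i j, i != j -> [disjoint P i & P j]) -> v \in P i -> v \in P j -> i = j.
Proof.
move=> D vi vj; apply/eqP/negP => /negP /D ij.
by rewrite (disjointFr ij vi) in vj.
Qed.

Lemma pick_family r (P : 'I_r -> {set T}) i v :
  (forall i j, i != j -> [disjoint P i & P j]) -> v \in P i ->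
  [pick j | v \in P j] = Some i.
Proof.
move=> D vi; case: pickP => [j vj|/(_ i)]; last by rewrite vi.
by rewrite (disjoint_family_inj D vi vj).
Qed.

Lemma pick_family_none r (P : 'I_r -> {set T}) (Z : {set T}) v :
  (forall i, P i \subset Z) -> v \notin Z -> [pick j | v \in P j] = None.
Proof.
move=> D vi; case: pickP => [j vj|//].
by rewrite (subsetP (D j) v vj) in vi.
Qed.

Lemma PhiV v : v \in V -> Phi v \in V'.
Proof. by move=> vV; rewrite -Phi_V imset_f. Qed.

Lemma VP'_disj i j : i != j -> [disjoint VP' i & VP' j].
Proof.
move=> ij; rewrite !VP'_def -setI_eq0; apply/eqP/setP => a; rewrite !inE.
apply/negP => /andP [/imsetP [v vi ->] /imsetP [u uj E]].
have vu := Phi_inj (VP_V vi) (VP_V uj) E; rewrite -{}vu in uj.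
by rewrite (disjoint_family_inj VP_disj vi uj) eqxx in ij.
Qed.

Lemma VP_sub i : VP i \subset V.
Proof. by apply/subsetP => v; exact: VP_V. Qed.

Lemma VP'_sub i : VP' i \subset V'.
Proof. by rewrite VP'_def -Phi_V imsetS // VP_sub. Qed.

Lemma WP_sub k : WP k \subset W.
Proof. by apply/subsetP => v; exact: WP_W. Qed.

Lemma V'F v : v \in V -> v \in V' = false.
Proof. by case: disj => D _ _ _ _; exact: disjointFr. Qed.

Lemma VF v : v \in V' -> v \in V = false.
Proof. by case: disj => D _ _ _ _; exact: disjointFl. Qed.

Lemma W_notin w : w \in W -> [/\ w \notin V, w \notin V' & w \notin X].
Proof.
case: disj => _ D1 _ D2 [_ D3] wW.
by rewrite (disjointFl D1) ?(disjointFl D2) ?(disjointFr D3).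
Qed.

Lemma X_notin x : x \in X -> [/\ x \notin V, x \notin V' & x \notin W].
Proof.
case: disj => _ _ D1 _ [D2 D3] xX.
by rewrite (disjointFl D1) ?(disjointFl D2) ?(disjointFl D3).
Qed.

Lemma side_U i s v : v \in VP i -> side s v \in V :|: V'.
Proof.
move=> /VP_V vi; rewrite inE /side; case: s; last by rewrite vi.
by rewrite PhiV ?orbT.
Qed.

Lemma UX : [disjoint V :|: V' & X].
Proof. by rewrite -setI_eq0 setIUl setU_eq0 !setI_eq0; case: disj => _ _ -> _ [-> _]. Qed.

Lemma W_notU w : w \in W -> w \notin V :|: V'.
Proof. by case/W_notin => a b _; rewrite inE negb_or a. Qed.

Lemma X_notU w : w \in X -> w \notin V :|: V'.
Proof. by case/X_notin => a b _; rewrite inE negb_or a. Qed.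

Variant vertex_spec : T -> Prop :=
  | VertexU s i v of v \in VP i : vertex_spec (side s v)
  | VertexW k w of w \in WP k : vertex_spec w
  | VertexX x of x \in X : vertex_spec x.

Lemma vertexP a : vertex_spec a.
Proof.
have : a \in V :|: V' :|: W :|: X by rewrite cover inE.
rewrite !inE -!orbA => /or4P [].
- by rewrite -VP_cover => /bigcupP [i _ ai]; exact: (VertexU false ai).
- rewrite -Phi_V => /imsetP [v]; rewrite -VP_cover => /bigcupP [i _ ai] ->.
  exact: (VertexU true ai).
- by rewrite -WP_cover => /bigcupP [i _ ai]; exact: (VertexW ai).
exact: VertexX.
Qed.

Lemma pick_VP_none v : v \notin V -> [pick i | v \in VP i] = None.
Proof. by move=> vV; rewrite (pick_family_none VP_sub). Qed.

Lemma swap_side i s v : v \in VP i -> swap (side s v) = side (~~ s) v.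
Proof.
move=> /VP_V vV; rewrite /swap /side; case: s; last by rewrite vV.
rewrite VF ?PhiV //; case: pickP => [u /andP [uV /eqP E]|/(_ v)].
  exact: Phi_inj.
by rewrite vV eqxx.
Qed.

Lemma swap_off a : a \notin V :|: V' -> swap a = a.
Proof. by rewrite inE negb_or /swap => /andP [/negPf -> /negPf ->]. Qed.

Lemma block_side i s v : v \in VP i -> block (side s v) = side s @: VP i.
Proof.
move=> vi; have vV := VP_V vi; rewrite /block; case: s.
  rewrite pick_VP_none ?VF ?PhiV // (pick_family (i := i) VP'_disj).
    by rewrite VP'_def.
  by rewrite VP'_def imset_f.
by rewrite (pick_family VP_disj vi) imset_id.
Qed.

Lemma block_W k w : w \in WP k -> block w = WP k.
Proof.
move=> wk; have [wV wV' _] := W_notin (WP_W wk).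
rewrite /block pick_VP_none // (pick_family_none VP'_sub) //.
by rewrite (pick_family WP_disj wk).
Qed.

Lemma block_X x : x \in X -> block x = [set x].
Proof.
move=> /X_notin [xV xV' xW].
by rewrite /block pick_VP_none // (pick_family_none VP'_sub) // (pick_family_none WP_sub).
Qed.

Lemma weight_side (F : fieldType) (f : 'I_p -> F) i s v : v \in VP i ->
  block_weight f (side s v) = (-1) ^+ s * f i.
Proof.
move=> vi; have vV := VP_V vi; rewrite /block_weight; case: s.
  rewrite pick_VP_none ?VF ?PhiV // (pick_family (i := i) VP'_disj).
    by rewrite expr1 mulN1r.
  by rewrite VP'_def imset_f.
by rewrite (pick_family VP_disj vi) expr0 mul1r.
Qed.

Lemma weight_off (F : fieldType) (f : 'I_p -> F) a : a \notin V :|: V' -> block_weight f a = 0.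
Proof.
rewrite inE negb_or => /andP [aV aV'].
by rewrite /block_weight pick_VP_none // (pick_family_none VP'_sub).
Qed.

Lemma scale_side (F : fieldType) (al : F) i s v : v \in VP i ->
  scale_weight al (side s v) = al.
Proof. by move=> vi; rewrite /scale_weight (side_U s vi). Qed.

Lemma scale_off (F : fieldType) (al : F) a : a \notin V :|: V' -> scale_weight al a = -1.
Proof. by rewrite /scale_weight => /negPf ->. Qed.

Lemma block_refl a : a \in block a.
Proof.
case: (vertexP a) => [s i v vi|k w wk|x xX].
- by rewrite (block_side s vi) imset_f.
- by rewrite (block_W wk).
by rewrite block_X // inE.
Qed.

Lemma blockP a b : b \in block a ->
  [\/ exists s i u v, [/\ u \in VP i, v \in VP i, a = side s u & b = side s v],
      exists2 k, a \in WP k & b \in WP k | a \in X /\ b = a].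
Proof.
case: (vertexP a) => [s i v vi|k w wk|x xX].
- rewrite (block_side s vi) => /imsetP [u ui ->].
  by apply: Or31; exists s, i, v, u.
- by rewrite (block_W wk) => bk; apply: Or32; exists k.
by rewrite block_X // inE => /eqP ->; apply: Or33.
Qed.

Lemma block_eq a b : b \in block a -> block b = block a.
Proof.
case/blockP => [[s [i [u [v [ui vi -> ->]]]]]|[k ak bk]|[_ ->] //].
  by rewrite (block_side _ ui) (block_side _ vi).
by rewrite (block_W ak) (block_W bk).
Qed.

Lemma swapK : involutive swap.
Proof.
move=> a; case: (vertexP a) => [s i v vi|k w wk|x xX].
- by rewrite (swap_side _ vi) (swap_side _ vi) negbK.
- by rewrite !swap_off ?W_notU // (WP_W wk).
by rewrite !swap_off ?X_notU.
Qed.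

Lemma block_swap a b : b \in block a -> swap b \in block (swap a).
Proof.
case/blockP => [[s [i [u [v [ui vi -> ->]]]]]|[k ak bk]|[aX ->]].
- by rewrite (swap_side _ ui) (swap_side _ vi) (block_side _ ui) imset_f.
- by rewrite !swap_off ?W_notU ?(WP_W ak) ?(WP_W bk) // (block_W ak).
exact: block_refl.
Qed.

Lemma block_U a b : b \in block a -> (b \in V :|: V') = (a \in V :|: V').
Proof.
case/blockP => [[s [i [u [v [ui vi -> ->]]]]]|[k ak bk]|[aX -> //]].
  by rewrite (side_U _ ui) (side_U _ vi).
by rewrite !(negPf (W_notU _)) // ?(WP_W ak) ?(WP_W bk).
Qed.

Lemma weight_block (F : fieldType) (f : 'I_p -> F) a b : b \in block a ->
  block_weight f b = block_weight f a.
Proof.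
case/blockP => [[s [i [u [v [ui vi -> ->]]]]]|[k ak bk]|[aX -> //]].
  by rewrite (weight_side _ _ ui) (weight_side _ _ vi).
by rewrite !weight_off // W_notU // ?(WP_W ak) ?(WP_W bk).
Qed.

Lemma scale_block (F : fieldType) (al : F) a b : b \in block a ->
  scale_weight al b = scale_weight al a.
Proof. by move/block_U => E; rewrite /scale_weight E. Qed.

Lemma weight_swap (F : fieldType) (f : 'I_p -> F) a :
  block_weight f (swap a) = - block_weight f a.
Proof.
case: (vertexP a) => [s i v vi|k w /WP_W wk|x xX].
- by rewrite (swap_side s vi) !(weight_side _ _ vi); case: s; ring.
- by rewrite swap_off ?W_notU // weight_off ?W_notU // oppr0.
by rewrite swap_off ?X_notU // weight_off ?X_notU // oppr0.
Qed.

Lemma scale_swap (F : fieldType) (al : F) a : scale_weight al (swap a) = scale_weight al a.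
Proof.
case: (vertexP a) => [s i v vi|k w /WP_W wk|x xX].
- by rewrite (swap_side s vi) !(scale_side _ _ vi).
- by rewrite swap_off ?W_notU.
by rewrite swap_off ?X_notU.
Qed.

Lemma side_inj i s : {in VP i &, injective (side s)}.
Proof.
by move=> u v /VP_V uV /VP_V vV; case: s => //; exact: Phi_inj.
Qed.

(** * The hypotheses in one-directional form *)

Variables (delta : 'I_p -> int).

(** Of each two-directional hypothesis only one direction is kept; the other is the same record for
    the converse digraph. Unlinked or fully linked becomes a constant Boolean [f]. *)
Record switchable (e : rel T) : Prop := Switchable {
  sw_UX : forall i x s, x \in X ->
    exists f, {in VP i, forall v, e (side s v) x = f};
  sw_WX : forall k x, x \in X ->
    (exists f, {in WP k, forall w, e w x = f}) \/
    (\sum_(w in WP k) e w x)%N.*2 = #|WP k|;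
  sw_WW : forall k l, {in WP k &, forall w w',
    (\sum_(y in WP l) e w y = \sum_(y in WP l) e w' y)%N};
  sw_UW : forall i k, exists f, forall s,
    {in VP i & WP k, forall v w, e (side s v) w = f};
  sw_iso : {in V &, forall u v, e (Phi u) (Phi v) = e u v};
  sw_VV : forall i j, {in VP i &, forall u u',
    (\sum_(y in VP j) e u y = \sum_(y in VP j) e u' y)%N};
  sw_matching : forall i s, {in VP i &, forall u v,
    e (side s u) (side (~~ s) v) = (u == v)};
  sw_cross : forall i j, i != j ->
    (exists f, forall s, {in VP i & VP j, forall u v,
       e (side s u) (side (~~ s) v) = f}) \/
    [/\ delta i = delta j,
        {in VP i & VP j, forall u v, e u (Phi v) = ~~ e (Phi u) v}
      & forall s, {in VP i, forall u,
         (\sum_(v in VP j) e (side s u) (side (~~ s) v))%N.*2 = #|VP j|}];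
  sw_neq : forall i j, i != j -> delta i <> delta j ->
    exists f, {in VP i & VP j, forall u v, e u v = f};
  sw_degU : forall i, {in VP i &, forall u v,
    delta i = (\sum_(x in X) e (Phi v) x)%N%:Z - (\sum_(x in X) e u x)%N%:Z};
  sw_degW : forall k, {in WP k &, forall w w',
    (\sum_(x in X) e w x = \sum_(x in X) e w' x)%N}
}.

Definition switch_sets : {set {set T}} :=
  [set VP i :|: VP' i | i : 'I_p] :|: [set WP k | k : 'I_q].

Lemma switch_sets_disjoint Y : Y \in switch_sets -> [disjoint Y & X].
Proof.
case: disj => _ _ D1 _ [D2 D3]; rewrite inE => /orP [] /imsetP [i _ ->].
  rewrite -setI_eq0 setIUl setU_eq0 !setI_eq0.
  by rewrite (disjointWl (VP_sub i) D1) (disjointWl (VP'_sub i) D2).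
by rewrite (disjointWl (WP_sub i) D3).
Qed.

Lemma side_VP i s v : v \in VP i -> side s v \in VP i :|: VP' i.
Proof.
by move=> vi; rewrite inE VP'_def /side; case: s; rewrite ?vi ?imset_f ?orbT.
Qed.

Lemma side_VPE i j s v : v \in VP i -> side s v \in VP j :|: VP' j -> i = j.
Proof.
move=> vi; have vV := VP_V vi; rewrite inE => /orP []; rewrite /side; case: s => vj.
- by have := VP_V vj; rewrite VF // PhiV.
- exact: disjoint_family_inj VP_disj vi vj.
- apply: (disjoint_family_inj VP'_disj _ vj); by rewrite VP'_def imset_f.
by have := subsetP (VP'_sub j) _ vj; rewrite V'F.
Qed.

Lemma switch_sets_U i s v Z : v \in VP i -> Z \in switch_sets -> side s v \in Z ->
  Z = VP i :|: VP' i.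
Proof.
move=> vi; rewrite inE => /orP [] /imsetP [j _ ->] vj.
  by rewrite (side_VPE vi vj).
by have := side_U s vi; rewrite (negPf (W_notU (WP_W vj))).
Qed.

Lemma switch_sets_W k w Z : w \in WP k -> Z \in switch_sets -> w \in Z -> Z = WP k.
Proof.
move=> wk; have := W_notU (WP_W wk); rewrite inE negb_or => /andP [wV wV'].
rewrite inE => /orP [] /imsetP [j _ ->].
  by rewrite inE => /orP [/VP_V|/(subsetP (VP'_sub j))] H; rewrite H in wV wV'.
by move=> wj; rewrite (disjoint_family_inj WP_disj wk wj).
Qed.

Lemma sum_pair i (h : T -> nat) :
  (\sum_(y in VP i :|: VP' i) h y = \sum_(v in VP i) h v + \sum_(v in VP i) h (Phi v))%N.
Proof.
transitivity (\sum_(y in [predU VP i & VP' i]) h y)%N.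
  by apply: eq_bigl => y; rewrite !inE.
rewrite bigU /=; last first.
  case: disj => D _ _ _ _.
  by rewrite (disjointWl (VP_sub i)) // (disjointWr (VP'_sub i)).
by rewrite VP'_def big_imset //= => u v /VP_V uV /VP_V; exact: Phi_inj.
Qed.

(** * Checking the intertwining conditions over a field of characteristic 0 *)

Section OverField.
Variable F : fieldType.
Hypothesis F_pchar0 : [pchar F] =i pred0.

Definition adjF (e : rel T) (a b : T) : F := (e a b)%:R.

Definition unmatched (e : rel T) (a b : T) : F :=
  adjF e a b - matching F swap (V :|: V') a b.

Lemma adjF_sum e a (Y : {set T}) :
  \sum_(y in Y) adjF e a y = (\sum_(y in Y) e a y)%N%:R.
Proof. by rewrite natr_sum. Qed.

Lemma swap_X x : x \in X -> swap x = x.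
Proof. by move/X_notU; exact: swap_off. Qed.

Lemma off_spec (al : F) (f : 'I_p -> F) a : a \notin V :|: V' ->
  [/\ swap a = a, scale_weight al a = -1 & block_weight f a = 0].
Proof. by move=> aU; rewrite swap_off // scale_off // weight_off. Qed.

Lemma unmatched_off e a b : a \notin V :|: V' \/ b \notin V :|: V' ->
  unmatched e a b = adjF e a b.
Proof.
rewrite /unmatched /matching => ab.
case: (boolP (a \in V :|: V')) ab => [aU|_ _]; last by rewrite mul0r subr0.
case=> // bU; case: eqP => E; last by rewrite mulr0 subr0.
case/negP: bU; rewrite -E; case: (vertexP a) aU => [s i v vi _|k w wk|x xX].
- by rewrite (swap_side _ vi) (side_U _ vi).
- by rewrite (negPf (W_notU (WP_W wk))).
by rewrite (negPf (X_notU xX)).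
Qed.

Lemma unmatchedX e a x : x \in X -> unmatched e a x = adjF e a x.
Proof. by move/X_notU => xU; apply: unmatched_off; right. Qed.

Lemma avg_unmatchedX e a x : x \in X ->
  avg block ((unmatched e)^~ x) a = avg block ((adjF e)^~ x) a.
Proof. by move=> xX; apply: eq_avg => c _; exact: unmatchedX. Qed.

Lemma avg_side (h : T -> F) i s v : v \in VP i ->
  avg block h (side s v) = (\sum_(c in VP i) h (side s c)) / #|VP i|%:R.
Proof.
move=> vi; rewrite /avg (block_side s vi) big_imset ?card_in_imset //; exact: side_inj.
Qed.

Lemma cardF_gt0 (Y : {set T}) v : v \in Y -> (0 < #|Y|)%N.
Proof. by move=> vY; rewrite card_gt0; apply/set0Pn; exists v. Qed.

(* A switching of (V_i u V_i', x) is possible exactly when x sees V_i and V_i'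
   differently, so in all cases its effect is to exchange the two. *)
Lemma switch_all_U e i s v x : switchable e -> v \in VP i -> x \in X ->
  switch_all e X switch_sets (side s v) x = e (side (~~ s) v) x.
Proof.
move=> G vi xX; have [f0 H0] := sw_UX G i false xX; have [f1 H1] := sw_UX G i true xX.
rewrite (switch_all_to _ switch_sets_disjoint (Y := VP i :|: VP' i)) //; first last.
- exact: side_VP.
- by move=> Z ZB; exact: switch_sets_U.
- by apply/setUP; left; apply/imsetP; exists i.
have E : half_linked_to e (VP i :|: VP' i) x = (f0 != f1).
  rewrite half_linked_toE sum_pair -sum1_card sum_pair.
  have -> : (\sum_(y in VP i) e y x = \sum_(y in VP i) f0)%N.
    by apply: eq_bigr => y yi; exact: (congr1 nat_of_bool (H0 y yi)).
  have -> : (\sum_(y in VP i) e (Phi y) x = \sum_(y in VP i) f1)%N.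
    by apply: eq_bigr => y yi; exact: (congr1 nat_of_bool (H1 y yi)).
  rewrite !sum_nat_const; have := cardF_gt0 vi.
  by case: f0 {H0}; case: f1 {H1}; move=> /=; lia.
rewrite E; case: s; rewrite /= (H1 v vi) (H0 v vi : e v x = f0);
 by case: f0 {H0 E}; case: f1 {H1}.
Qed.

Lemma switch_crossing e : switchable e ->
  crossing_switch block swap X (V :|: V') (unmatched e)
    (unmatched (switch_all e X switch_sets)).
Proof.
move=> G u x uX xX.
have sX : swap u \notin X by apply: contra uX => H; rewrite -(swapK u) swap_X.
rewrite !unmatchedX // !avg_unmatchedX //.
move: uX sX; case: (vertexP u) => [s i v vi|k w wk|y yX]; last by rewrite yX.
- move=> uX sX.
  have A t : avg block ((adjF e)^~ x) (side t v) = adjF e (side t v) x.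
    have [f H] := sw_UX G i t xX; apply: (avg_const F_pchar0 block_refl) => c.
    by rewrite (block_side t vi) => /imsetP [c' c'i ->]; rewrite /adjF !H.
  by rewrite (swap_side s vi) !A subrr subr0 /adjF (switch_all_U s G vi xX).
move=> uX sX; rewrite (negPf (W_notU (WP_W wk))); split=> //.
rewrite swap_off ?W_notU ?(WP_W wk) //.
have n0 := cardF_gt0 wk; have nF := natF_neq0 F_pchar0 n0.
rewrite {1}/adjF (switch_all_to _ switch_sets_disjoint (Y := WP k)) //; first last.
- by move=> Z ZB; exact: switch_sets_W.
- by apply/setUP; right; apply/imsetP; exists k.
rewrite /avg (block_W wk) -natr_sum half_linked_toE.
(* On a constant column the mean is the common value, [2 avg - b] is [b], and a nonempty block is
   not half-linked, so nothing is switched. On a half-linked one the mean is 1/2, and [2 avg - b] is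
   [1 - b], the complement. *)
case: (sw_WX G k xX) => [[f H]|H].
  rewrite (eq_bigr (fun=> f : nat)) => [|y yi]; last by rewrite (H y yi).
  rewrite sum_nat_const /adjF (H w wk) natrM mulrAC divff // mul1r.
  case: f {H}; rewrite ?muln1 ?muln0; last by rewrite eq_sym double0 eqn0Ngt n0; ring.
  by rewrite ifF; [ring|apply/negP => /eqP; lia].
rewrite H eqxx -H -addnn natrD.
by rewrite /adjF; case: (e w x) => /=; field; rewrite -natrD addnn H.
Qed.

Lemma unmatched_side e i j s s' u v : u \in VP i -> v \in VP j ->
  unmatched e (side s u) (side s' v) =
  adjF e (side s u) (side s' v) - ((s' == ~~ s) && (u == v))%:R.
Proof.
move=> ui vj; rewrite /unmatched /matching (side_U _ ui) mul1r (swap_side _ ui).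
congr (_ - _%:R); case: (eqVneq s' (~~ s)) => [->|H] /=.
  have [<-|uv] := eqVneq u v; first by rewrite eqxx.
  case: eqP => //; case: (s) => /= E; first by rewrite E eqxx in uv.
  by rewrite (Phi_inj (VP_V ui) (VP_V vj) E) eqxx in uv.
case: eqP => //; have uV := VP_V ui; have vV := VP_V vj.
case: s s' H => [] [] //= _ E; first by have := VF (PhiV vV); rewrite -E uV.
by have := VF (PhiV uV); rewrite E vV.
Qed.


Variables (al0 tau : F).
Let al := scale_weight al0.
Let be := block_weight (fun i => tau * (delta i)%:~R).

Definition pair_kernel e s s' (u v : T) : F := unmatched e (side s u) (side s' v).

Lemma pair_kernel_same e r i j u v : switchable e -> u \in VP i -> v \in VP j ->
  pair_kernel e r r u v = adjF e u v.
Proof.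
move=> G ui vj; rewrite /pair_kernel (unmatched_side _ _ _ ui vj).
have -> : (r == ~~ r) = false by case: (r).
rewrite subr0; case: r => //.
by rewrite /adjF /= (sw_iso G (VP_V ui) (VP_V vj)).
Qed.

Lemma pair_kernel_cross e r i j u v : u \in VP i -> v \in VP j ->
  pair_kernel e r (~~ r) u v = adjF e (side r u) (side (~~ r) v) - (u == v)%:R.
Proof. by move=> ui vj; rewrite /pair_kernel (unmatched_side _ _ _ ui vj) eqxx. Qed.

Lemma pair_kernel_diag e r i u v : switchable e -> u \in VP i -> v \in VP i ->
  pair_kernel e r (~~ r) u v = 0.
Proof.
move=> G ui vj; rewrite (pair_kernel_cross _ _ ui vj).
by rewrite /adjF (sw_matching G _ ui vj) subrr.
Qed.

Lemma pair_kernel_offdiag e r i j u v : i != j -> u \in VP i -> v \in VP j ->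
  pair_kernel e r (~~ r) u v = adjF e (side r u) (side (~~ r) v).
Proof.
move=> ij ui vj; rewrite (pair_kernel_cross _ _ ui vj).
case: eqP => [E|]; last by rewrite subr0.
by rewrite -E in vj; rewrite (disjoint_family_inj VP_disj ui vj) eqxx in ij.
Qed.

(* Up to exchanging V and V', the block from V_i to V_j is constant, or it is
   preserved (same sides) or complemented (opposite sides) by the exchange. *)
Lemma pair_kernelP e s s' i j : switchable e ->
  (exists c, {in VP i & VP j, forall u v,
     pair_kernel e s s' u v = c /\ pair_kernel e (~~ s) (~~ s') u v = c}) \/
  delta i = delta j /\ {in VP i & VP j, forall u v,
     pair_kernel e (~~ s) (~~ s') u v =
       if s == s' then pair_kernel e s s' u v else 1 - pair_kernel e s s' u v}.
Proof.
move=> G; have [<-{s'}|ss'] := eqVneq s s'.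
  have [dij|dij] := eqVneq (delta i) (delta j).
    by right; split=> // u v ui vj; rewrite !(pair_kernel_same _ G ui vj).
  have ij : i != j by apply: contra_neq dij => ->.
  left; have [f Hf] := sw_neq G ij (elimN eqP dij).
  by exists f%:R => u v ui vj; rewrite !(pair_kernel_same _ G ui vj) /adjF Hf.
have -> : s' = ~~ s by case: s s' ss' => [] [].
have [<-|ij] := eqVneq i j.
  by left; exists 0 => u v ui vj; rewrite !(pair_kernel_diag _ G ui vj).
case: (sw_cross G ij) => [[f Hf]|[dij Hd _]].
  left; exists f%:R => u v ui vj.
  by rewrite !(pair_kernel_offdiag _ _ ij ui vj) /adjF !Hf.
right; split=> // u v ui vj; rewrite !(pair_kernel_offdiag _ _ ij ui vj) /adjF.
by case: (s) => /=; rewrite (Hd u v ui vj); case: (e (Phi u) v); rewrite /= ?subr0 ?subrr.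
Qed.

(** For equal sides this is equitability transported by the isomorphism. For opposite sides the
    block is 0 if [i = j], the matching being removed, and otherwise it is constant or has exactly
    half of its entries equal to 1 in each row. *)
Lemma pair_rowsum e s s' i j : switchable e ->
  exists r, {in VP i, forall u, \sum_(v in VP j) pair_kernel e s s' u v = r /\
    \sum_(v in VP j) pair_kernel e (~~ s) (~~ s') u v = r}.
Proof.
move=> G; have [->|/set0Pn [u0 u0i]] := eqVneq (VP i) set0.
  by exists 0 => u; rewrite inE.
have [<-{s'}|ss'] := eqVneq s s'.
  exists (\sum_(v in VP j) adjF e u0 v) => u ui.
  have E t : \sum_(v in VP j) pair_kernel e t t u v = \sum_(v in VP j) adjF e u0 v.
    rewrite adjF_sum -(sw_VV G j ui u0i) -adjF_sum; apply: eq_bigr => v vj.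
    exact: pair_kernel_same G ui vj.
  by split; exact: E.
have -> : s' = ~~ s by case: s s' ss' => [] [].
have [<-|ij] := eqVneq i j.
  exists 0 => u ui; have E t : \sum_(v in VP i) pair_kernel e t (~~ t) u v = 0.
    by rewrite big1 // => v vi; exact: pair_kernel_diag G ui vi.
  by split; exact: E.
have E t u : u \in VP i -> \sum_(v in VP j) pair_kernel e t (~~ t) u v =
    (\sum_(v in VP j) e (side t u) (side (~~ t) v))%N%:R.
  move=> ui; rewrite natr_sum; apply: eq_bigr => v vj.
  exact: pair_kernel_offdiag ij ui vj.
case: (sw_cross G ij) => [[f Hf]|[_ _ Hh]].
  exists (\sum_(v in VP j) f)%N%:R => u ui; rewrite !E //.
  by split; congr _%:R; apply: eq_bigr => v vj; rewrite Hf.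
exists (#|VP j|%:R / 2) => u ui; rewrite !E //.
have n2 : 2 != 0 :> F by exact: natF_neq0.
by split; [rewrite -(Hh s u ui)|rewrite -(Hh (~~ s) u ui)];
   rewrite -mul2n natrM mulrAC divff ?mul1r.
Qed.

Lemma pair_kernel_converse e s s' u v :
  pair_kernel (converse e) s s' u v = pair_kernel e s' s v u.
Proof.
rewrite /pair_kernel /unmatched /adjF /converse; congr (_ - _).
exact: (matching_sym swapK (off_spec 0 (fun=> 0))).
Qed.

Lemma pair_colsum e s s' i j : switchable (converse e) ->
  exists r, {in VP j, forall v, \sum_(u in VP i) pair_kernel e s s' u v = r /\
    \sum_(u in VP i) pair_kernel e (~~ s) (~~ s') u v = r}.
Proof.
move=> G; have [r Hr] := pair_rowsum s' s j i G; exists r => v vj.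
have [R1 R2] := Hr v vj.
by split; [rewrite -R1|rewrite -R2]; apply: eq_bigr => u _; rewrite pair_kernel_converse.
Qed.

Lemma avg_col e i j s s' u v : u \in VP i -> v \in VP j ->
  avg block (unmatched e (side s u)) (side s' v) =
  (\sum_(c in VP j) pair_kernel e s s' u c) / #|VP j|%:R.
Proof. by move=> ui vj; rewrite (avg_side _ _ vj). Qed.

Lemma avg_row e i j s s' u v : u \in VP i -> v \in VP j ->
  avg block ((unmatched e)^~ (side s' v)) (side s u) =
  (\sum_(c in VP i) pair_kernel e s s' c v) / #|VP i|%:R.
Proof. by move=> ui vj; rewrite (avg_side _ _ ui). Qed.

Definition inner_spec e u v : Prop :=
  let b := unmatched e in
  [/\ avg block (b u) v = avg block (b^~ v) u,
      avg block (b^~ (swap v)) (swap u) = avg block (b^~ v) u,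
      be u * (b (swap u) v - avg block (b^~ v) (swap u)) =
        - be v * (b u (swap v) - avg block (b^~ (swap v)) u)
    & (al u - al v) * (b u v - avg block (b^~ v) u) = 0].

(** The means come from double counting constant row and column sums, and [al] is the same on all of
    U. The content is the [be] condition, where the trichotomy of [pair_kernelP] enters. *)
Lemma inner_pair e i j s s' u v : switchable e -> switchable (converse e) ->
  u \in VP i -> v \in VP j -> inner_spec e (side s u) (side s' v).
Proof.
move=> G Gc ui vj; have [r Hr] := pair_rowsum s s' i j G.
have [k Hk] := pair_colsum s s' i j Gc.
have ni := cardF_gt0 ui; have nj := cardF_gt0 vj.
have niF := natF_neq0 F_pchar0 ni.
rewrite /inner_spec (swap_side _ ui) (swap_side _ vj).
rewrite (avg_col _ _ _ ui vj) !(avg_row _ _ _ ui vj).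
have [R1 _] := Hr u ui; have [K1 K2] := Hk v vj; rewrite R1 K1 K2.
have [a1 a2] : al (side s u) = al0 /\ al (side s' v) = al0.
  by rewrite /al (scale_side _ _ ui) (scale_side _ _ vj).
split=> //; last by rewrite a1 a2 subrr mul0r.
  apply: (double_count F_pchar0 (b := pair_kernel e s s') ni nj) => a.
    by case/Hr.
  by case/Hk.
rewrite /be (weight_side _ _ ui) (weight_side _ _ vj) -/(pair_kernel e (~~ s) s' u v).
rewrite -/(pair_kernel e s (~~ s') u v).
have const (h : T -> T -> F) c : {in VP i & VP j, forall u v, h u v = c} ->
    (\sum_(a in VP i) h a v) / #|VP i|%:R = c.
  move=> H; rewrite (eq_bigr (fun=> c)) => [|a ai]; last exact: H.
  by rewrite sumr_const -[X in X / _]mulr_natr mulfK.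
have := pair_kernelP (~~ s) s' i j G; rewrite negbK => -[[c Hc]|[dij Hd]].
  have H1 a b : a \in VP i -> b \in VP j -> pair_kernel e (~~ s) s' a b = c.
    by move=> ai bj; have [] := Hc a b ai bj.
  have H2 a b : a \in VP i -> b \in VP j -> pair_kernel e s (~~ s') a b = c.
    by move=> ai bj; have [] := Hc a b ai bj.
  by rewrite (const _ c H1) (const _ c H2) H1 // H2 // !subrr !mulr0.
rewrite (Hd u v ui vj) dij (eq_bigr _ (fun a ai => Hd a v ai vj)).
(* Here both deltas agree, so the two weights differ at most by sign. If [s' = ~~ s], the weights
   are opposite and the two deviations equal; if [s' = s], the weights are equal and complementing
   makes the deviations opposite. *)
have [E|E] := eqVneq (~~ s) s'.
  rewrite -E; case: (s); rewrite /= ?expr0 ?expr1; ring.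
have -> : s' = s by case: s s' E {Hr Hk R1 K1 K2 a1 a2 Hd} => [] [].
have compl (h : T -> F) : (\sum_(a in VP i) (1 - h a)) / #|VP i|%:R =
    1 - (\sum_(a in VP i) h a) / #|VP i|%:R.
  by rewrite sumrB sumr_const mulrBl divff.
rewrite /= (compl (fun a => pair_kernel e (~~ s) s a v)); ring.
Qed.

Lemma inner_W e k l u v : switchable e -> switchable (converse e) ->
  u \in WP k -> v \in WP l -> inner_spec e u v.
Proof.
move=> G Gc uk vl; have uU := W_notU (WP_W uk); have vU := W_notU (WP_W vl).
rewrite /inner_spec /al /be !swap_off // !scale_off // !weight_off //.
have M : avg block (unmatched e u) v = avg block ((unmatched e)^~ v) u.
  have Sr a : \sum_(c in WP l) unmatched e a c = (\sum_(c in WP l) e a c)%N%:R.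
    rewrite natr_sum; apply: eq_bigr => c cl.
    by apply: unmatched_off; right; exact: W_notU (WP_W cl).
  have Sc b : \sum_(c in WP k) unmatched e c b = (\sum_(c in WP k) converse e b c)%N%:R.
    rewrite natr_sum; apply: eq_bigr => c ck.
    by apply: unmatched_off; left; exact: W_notU (WP_W ck).
  rewrite /avg (block_W uk) (block_W vl).
  apply: (double_count F_pchar0 (b := unmatched e) (cardF_gt0 uk) (cardF_gt0 vl)).
    by move=> a ak; rewrite !Sr (sw_WW G l ak uk).
  by move=> b bl; rewrite !Sc (sw_WW Gc k bl vl).
split=> //; last by rewrite subrr mul0r.
by rewrite oppr0 !mul0r.
Qed.

(** All deviations vanish, so the weights do not matter; this settles pairs between U and W, where
    [al] may differ. *)
Lemma inner_const e u v c :
  (forall a b, a \in block u \/ a \in block (swap u) ->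
     b \in block v \/ b \in block (swap v) -> unmatched e a b = c) ->
  inner_spec e u v.
Proof.
move=> H; rewrite /inner_spec.
have A a b : a = u \/ a = swap u -> b = v \/ b = swap v ->
    avg block ((unmatched e)^~ b) a = c.
  move=> Ha Hb; apply: (avg_const F_pchar0 block_refl) => d da; apply: H.
    by case: Ha da => -> ?; [left|right].
  by case: Hb => ->; [left|right]; exact: block_refl.
have A' : avg block (unmatched e u) v = c.
  apply: (avg_const F_pchar0 block_refl) => d da; apply: H; last by left.
  by left; exact: block_refl.
rewrite A' !A ?H; try by [left|right|left; exact: block_refl|right; exact: block_refl].
by rewrite !subrr !mulr0.
Qed.

Lemma block_sides i s v a : v \in VP i ->
  a \in block (side s v) \/ a \in block (swap (side s v)) ->
  exists t, exists2 u, u \in VP i & a = side t u.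
Proof.
move=> vi; rewrite (swap_side _ vi) !(block_side _ vi).
by case=> /imsetP [u ui ->]; [exists s, u|exists (~~ s), u].
Qed.

Lemma block_sideW k w a : w \in WP k ->
  a \in block w \/ a \in block (swap w) -> a \in WP k.
Proof.
by move=> wk; rewrite swap_off ?W_notU ?(WP_W wk) // (block_W wk) => -[].
Qed.

Lemma inner_pair_W e i k s v w : switchable e -> v \in VP i -> w \in WP k ->
  inner_spec e (side s v) w.
Proof.
move=> G vi wk; have [f Hf] := sw_UW G i k; apply: (inner_const (c := f%:R)) => a b.
move=> /(block_sides vi) [t [u ui ->]] /(block_sideW wk) bk.
rewrite unmatched_off /adjF ?Hf //; right; exact: W_notU (WP_W bk).
Qed.

Lemma inner_W_pair e i k s v w : switchable (converse e) -> v \in VP i -> w \in WP k ->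
  inner_spec e w (side s v).
Proof.
move=> G vi wk; have [f Hf] := sw_UW G i k; apply: (inner_const (c := f%:R)) => a b.
move=> /(block_sideW wk) ak /(block_sides vi) [t [u ui ->]].
rewrite unmatched_off; last by left; exact: W_notU (WP_W ak).
by rewrite /adjF; congr (nat_of_bool _)%:R; exact: Hf.
Qed.

Lemma unmatched_inner e : switchable e -> switchable (converse e) ->
  inner_compatible block swap al be X (unmatched e).
Proof.
move=> G Gc u v; case: (vertexP u) => [s i u' ui|k w wk|x ->] //;
  case: (vertexP v) => [s' j v' vj|l w' wl|x ->] // _ _.
- exact: inner_pair G Gc ui vj.
- exact: inner_pair_W G ui wl.
- exact: inner_W_pair Gc vj wk.
exact: inner_W G Gc wk wl.
Qed.

Definition deltaF (a : T) : F := block_weight (fun i => (delta i)%:~R) a.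

Lemma adjF_out_regular e : switchable e ->
  out_regular block swap X (V :|: V') (adjF e) deltaF.
Proof.
move=> G.
have D i s v u : v \in VP i -> u \in VP i ->
    \sum_(x in X) adjF e (side (~~ s) v) x - \sum_(x in X) adjF e (side s u) x
      = (-1) ^+ s * (delta i)%:~R.
  move=> vi ui; rewrite !adjF_sum; case: s => /=.
    by rewrite (sw_degU G vi ui) rmorphB /= expr1 mulN1r opprB.
  by rewrite (sw_degU G ui vi) rmorphB /= expr0 mul1r.
split=> [a c aX /blockP [[s [i [u [v [ui vi -> ->]]]]]|[k ak ck]|[aX' ->] //]|a].
(* The degree condition relates every vertex of V_i to every vertex of V_i', so two vertices on one
   side are compared through a single one on the other. *)
- by apply: (subrI (\sum_(x in X) adjF e (side (~~ s) u) x)); rewrite !(D i).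
- by rewrite !adjF_sum (sw_degW G ck ak).
case: (vertexP a) => [s i v vi _|k w wk|x xX].
- by rewrite (swap_side _ vi) (D i) // /deltaF (weight_side _ _ vi).
- by rewrite (negPf (W_notU (WP_W wk))).
by rewrite (negPf (X_notU xX)).
Qed.

Lemma pencil_det_switch e (x t t' w w' k : F) :
  switchable e -> switchable (converse e) ->
  al0 = 2 * (w + w') -> tau = t + t' ->
  (forall i, (2 * (w + w')) ^+ 2 + ((t + t') * (delta i)%:~R) ^+ 2 != 0) ->
  \det (mx_of (pencil (adjF e) x t t' w w' k)) =
  \det (mx_of (pencil (adjF (switch_all e X switch_sets)) x t t' w w' k)).
Proof.
move=> G Gc Eal Etau nz.
have U_off a : a \notin V :|: V' -> [/\ swap a = a, al a = -1 & be a = 0].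
  exact: off_spec.
have nz' a : al a ^+ 2 + be a ^+ 2 != 0.
  case: (vertexP a) => [s i v vi|l b bl|y yX].
  - rewrite /al /be (scale_side _ _ vi) (weight_side _ _ vi) exprMn sqrr_sign.
    by rewrite mul1r Eal Etau.
  - have [_ -> ->] := U_off b (W_notU (WP_W bl)).
    by rewrite expr0n sqrrN expr1n addr0 oner_eq0.
  have [_ -> ->] := U_off y (X_notU yX).
  by rewrite expr0n sqrrN expr1n addr0 oner_eq0.
apply: (pencil_det F_pchar0 block_refl block_eq swapK block_swap
  (scale_block al0) (weight_block _) (scale_swap al0) (weight_swap _) nz'
  block_X swap_X U_off block_U UX (dl := deltaF)).
- by move=> u v uv; rewrite /adjF (switch_all_same _ switch_sets_disjoint uv).
- exact: switch_crossing.
- move=> u y uX yX; have := switch_crossing Gc uX yX.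
  have H a b : unmatched (converse e) a b = unmatched e b a.
    rewrite /unmatched /adjF /converse.
    by rewrite (matching_sym swapK (off_spec 0 (fun=> 0))).
  have H' a b : unmatched (switch_all (converse e) X switch_sets) a b =
      unmatched (switch_all e X switch_sets) b a.
    rewrite /unmatched /adjF switch_all_converse.
    by rewrite (matching_sym swapK (off_spec 0 (fun=> 0))).
  have HA a : avg block ((unmatched (converse e))^~ y) a = avg block (unmatched e y) a.
    by apply: eq_avg => c _; exact: H.
  by rewrite H H' !HA.
- exact: unmatched_inner.
- exact: adjF_out_regular.
- exact: (adjF_out_regular Gc).
move=> a aU; rewrite /al /be /deltaF.
case: (vertexP a) aU => [s i v vi _|l b bl|y yX].
- rewrite (scale_side _ _ vi) !(weight_side _ _ vi) Eal Etau; split=> //; ring.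
- by rewrite (negPf (W_notU (WP_W bl))).
by rewrite (negPf (X_notU yX)).
Qed.

End OverField.
End Blocks.

(** * The determinants of a digraph and of its complement as pencils *)

Section EtaPencil.
Variables (R : comNzRingType) (F : fieldType) (f : {rmorphism R -> F}) (T : finType).
Variables (x t t' w w' : R).

Lemma eta_det_pencil (e : rel T) : f (eta_det e x t t' w w') =
  \det (mx_of (pencil (adjF F e) (f x) (f t) (f t') (f w) (f w') 0)).
Proof.
rewrite /eta_det -det_map_mx; congr (\det _); apply/matrixP => i j.
rewrite !mxE !rmorphD !rmorphM !rmorphMn !rmorph_sum !rmorph1.
rewrite /pencil -(sum_enum_val (adjF F e _)) -(sum_enum_val (fun c => adjF F e c _)).
have -> : \sum_k f (adj_mx R e i k) = \sum_(k < #|T|) adjF F e (enum_val i) (enum_val k).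
  by apply: eq_bigr => k _; rewrite mxE rmorph_nat.
have -> : \sum_k f ((adj_mx R e)^T i k) = \sum_(k < #|T|) adjF F e (enum_val k) (enum_val i).
  by apply: eq_bigr => k _; rewrite !mxE rmorph_nat.
rewrite /adjF (inj_eq enum_val_inj); case: (i == j); rewrite ?mulr1n ?mulr0n /=; ring.
Qed.

Lemma adjF_compl (e : rel T) a b : simple_digraph e ->
  adjF F (dcompl e) a b = 1 - (a == b)%:R - adjF F e a b.
Proof.
rewrite /adjF /dcompl /= => se; case: eqP => [->|_] /=.
  by rewrite se subr0 subrr.
by case: (e a b); rewrite /= subr0 ?subrr ?subr0.
Qed.

(** Substitute J - I - A for A and n - 1 minus each degree for that degree: the identity matrix
    collects (t + t') (n - 1) - (w + w'), and J gets the coefficient w + w'. *)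
Lemma eta_det_compl (e : rel T) : simple_digraph e ->
  f (eta_det (dcompl e) x t t' w w') =
  \det (mx_of (pencil (adjF F e)
    (f x + (f t + f t') * (#|T|%:R - 1) - (f w + f w'))
    (- f t) (- f t') (- f w) (- f w') (f w + f w'))).
Proof.
move=> se; rewrite eta_det_pencil; congr (\det _); apply/matrixP => i j; rewrite !mxE.
move: (enum_val i) (enum_val j) => a b; rewrite /pencil.
have S c : \sum_d (c == d)%:R = 1 :> F.
  by rewrite -[RHS](sum_delta (fun=> 1) c); apply: eq_bigr => d _; rewrite mulr1.
have S1 c : \sum_d adjF F (dcompl e) c d = #|T|%:R - 1 - \sum_d adjF F e c d.
  under eq_bigr => d _ do rewrite adjF_compl //.
  by rewrite !sumrB sumr_const S.
have S2 c : \sum_d adjF F (dcompl e) d c = #|T|%:R - 1 - \sum_d adjF F e d c.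
  under eq_bigr => d _ do rewrite adjF_compl // eq_sym.
  by rewrite !sumrB sumr_const S.
rewrite S1 S2 !adjF_compl // (eq_sym b a); ring.
Qed.
End EtaPencil.

(** * The field of fractions and invertibility of the weights *)

Section Nonvanishing.
Let K : fieldType := {fraction {mpoly int[5]}}.
Let Y k : K := tofrac 'X_(inord k).

Lemma fraction_mpoly_pchar0 : [pchar K] =i pred0.
Proof.
apply/pcharf0P => n; rewrite -[n%:R](rmorph_nat (@tofrac {mpoly int[5]})) tofrac_eq0.
apply/eqP/eqP => [H|-> //].
have := congr1 (meval (fun=> 0 : int)) H; rewrite rmorph_nat rmorph0.
by move/eqP; rewrite Num.Theory.pnatr_eq0 => /eqP.
Qed.

Lemma weights_neq0 (d : int) :
  (2 * (Y 3 + Y 4)) ^+ 2 + ((Y 1 + Y 2) * d%:~R) ^+ 2 != 0.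
Proof.
rewrite /Y -(rmorph_int (@tofrac {mpoly int[5]})) -(rmorph_nat (@tofrac _) 2).
rewrite -!rmorphD -!rmorphM -!rmorphXn -rmorphD tofrac_eq0.
(* Evaluate at u_up = 1 and 0 for the other indeterminates: the term with [d] disappears and the
   value is 4, whatever [d] is. *)
apply/eqP => /(congr1 (meval (fun i => (i == inord 3)%:R : int))).
rewrite rmorph0 rmorphD !rmorphXn !rmorphM !rmorphD rmorph1 /= !mevalXU.
by rewrite -!val_eqE /= !inordK //= !addr0 mul0r mulr1 expr0n addr0.
Qed.

Lemma eta_eq_pencil (T : finType) (e e' : rel T) :
  \det (mx_of (pencil (adjF K e) (Y 0) (Y 1) (Y 2) (Y 3) (Y 4) 0)) =
  \det (mx_of (pencil (adjF K e') (Y 0) (Y 1) (Y 2) (Y 3) (Y 4) 0)) ->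
  eta e = eta e'.
Proof.
rewrite /Y => H; apply/eqP; rewrite -tofrac_eq; apply/eqP.
have E r := @eta_det_pencil _ K (@tofrac _) T 'X_(inord 0) 'X_(inord 1)
  'X_(inord 2) 'X_(inord 3) 'X_(inord 4) r.
exact: etrans (E e) (etrans H (esym (E e'))).
Qed.

Lemma eta_compl_eq_pencil (T : finType) (e e' : rel T) :
  simple_digraph e -> simple_digraph e' ->
  (forall x, \det (mx_of (pencil (adjF K e) x
       (- Y 1) (- Y 2) (- Y 3) (- Y 4) (Y 3 + Y 4))) =
     \det (mx_of (pencil (adjF K e') x
       (- Y 1) (- Y 2) (- Y 3) (- Y 4) (Y 3 + Y 4)))) ->
  eta (dcompl e) = eta (dcompl e').
Proof.
rewrite /Y => se se' H; apply/eqP; rewrite -tofrac_eq; apply/eqP.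
have E r := @eta_det_compl _ K (@tofrac _) T 'X_(inord 0) 'X_(inord 1)
  'X_(inord 2) 'X_(inord 3) 'X_(inord 4) r.
exact: etrans (E e se) (etrans (H _) (esym (E e' se'))).
Qed.
End Nonvanishing.

(** * From linking conditions to the one-directional form *)

Section FromLinking.
Variables (T : finType) (e : rel T) (V V' W X : {set T}) (Phi : T -> T) (p q : nat).
Variables (VP VP' : 'I_p -> {set T}) (WP : 'I_q -> {set T}) (delta : 'I_p -> int).
Hypothesis Phi_iso : induced_iso e V V' Phi.
Hypothesis V_equitable : equitable_partition e V VP.
Hypothesis VP'_def : forall i, VP' i = Phi @: VP i.
Hypothesis W_equitable : equitable_partition e W WP.
Hypothesis h1 : forall i x, x \in X ->
     (unlinked e [set x] (VP i) \/ fully_linked e [set x] (VP i)) /\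
     (unlinked e (VP i) [set x] \/ fully_linked e (VP i) [set x]).
Hypothesis h2 : forall i x, x \in X ->
     (unlinked e [set x] (VP' i) \/ fully_linked e [set x] (VP' i)) /\
     (unlinked e (VP' i) [set x] \/ fully_linked e (VP' i) [set x]).
Hypothesis h3 : forall i v v', v \in VP i -> v' \in VP' i ->
     delta i = (nedges e [set v'] X)%:Z - (nedges e [set v] X)%:Z /\
     delta i = (nedges e X [set v'])%:Z - (nedges e X [set v])%:Z.
Hypothesis h4 : forall k x, x \in X ->
     [\/ unlinked e [set x] (WP k), half_linked e [set x] (WP k)
       | fully_linked e [set x] (WP k)] /\
     [\/ unlinked e (WP k) [set x], half_linked_to e (WP k) x
       | fully_linked e (WP k) [set x]].
Hypothesis h5 : forall k w w', w \in WP k -> w' \in WP k ->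
     nedges e [set w] X = nedges e [set w'] X /\
     nedges e X [set w] = nedges e X [set w'].
Hypothesis h6 : forall i k,
     (unlinked e (VP i :|: VP' i) (WP k) \/
      fully_linked e (VP i :|: VP' i) (WP k)) /\
     (unlinked e (WP k) (VP i :|: VP' i) \/
      fully_linked e (WP k) (VP i :|: VP' i)).
Hypothesis h7 : forall i v, v \in VP i ->
     [/\ e v (Phi v), e (Phi v) v,
         nedges e [set v] (VP' i :\ Phi v) = 0%N
       & nedges e (VP' i :\ Phi v) [set v] = 0%N].
Hypothesis h8_neq : forall i j, i != j -> delta i <> delta j ->
     ((unlinked e (VP i) (VP' j) /\ unlinked e (VP' i) (VP j)) \/
      (fully_linked e (VP i) (VP' j) /\ fully_linked e (VP' i) (VP j))) /\
     ((unlinked e (VP i) (VP j) /\ unlinked e (VP' i) (VP' j)) \/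
      (fully_linked e (VP i) (VP j) /\ fully_linked e (VP' i) (VP' j))).
Hypothesis h8_eq : forall i j, i != j -> delta i = delta j ->
     [\/ unlinked e (VP i) (VP' j) /\ unlinked e (VP' i) (VP j),
         fully_linked e (VP i) (VP' j) /\ fully_linked e (VP' i) (VP j)
       | [/\ half_linked e (VP i) (VP' j),
             half_linked e (VP' i) (VP j),
             forall v', v' \in VP' j -> half_linked_to e (VP i) v'
           & forall v v' u, v \in VP i -> v' \in VP' j ->
               u \in VP j -> Phi u = v' ->
               (e v v' <-> ~ e (Phi v) u)]].

Lemma linked_const (Y Y' : {set T}) :
  unlinked e Y Y' \/ fully_linked e Y Y' ->
  exists f, {in Y & Y', forall u v, e u v = f}.
Proof.
case=> H; [exists false|exists true] => u v uY vY.
  exact: unlinkedP H uY vY.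
exact: fully_linkedP H uY vY.
Qed.

Let Phi_VP' i v : v \in VP i -> Phi v \in VP' i.
Proof. by move=> vi; rewrite VP'_def imset_f. Qed.

Let VPV i v : v \in VP i -> v \in V.
Proof. by case: V_equitable => _ _ <- _ vi; apply/bigcupP; exists i. Qed.

Let Phi_inj i : {in VP i &, injective Phi}.
Proof. by case: Phi_iso => inj _ _ u v /VPV uV /VPV vV; exact: inj. Qed.

Let side_mem i s v : v \in VP i -> side Phi s v \in if s then VP' i else VP i.
Proof. by case: s => // vi; exact: Phi_VP'. Qed.

Lemma sum_VP' i (h : T -> nat) : (\sum_(y in VP' i) h y = \sum_(v in VP i) h (Phi v))%N.
Proof. by rewrite VP'_def big_imset //; exact: Phi_inj. Qed.

Lemma card_VP' i : #|VP' i| = #|VP i|.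
Proof. by rewrite VP'_def card_in_imset //; exact: Phi_inj. Qed.

Lemma matching_edges i s : {in VP i &, forall u v,
  e (side Phi s u) (side Phi (~~ s) v) = (u == v)}.
Proof.
have off u v : u \in VP i -> v \in VP i -> u != v -> Phi v \in VP' i :\ Phi u.
  move=> ui vi uv; rewrite !inE Phi_VP' // andbT.
  by apply: contra uv => /eqP E; apply/eqP/(Phi_inj ui vi (esym E)).
move=> u v ui vi; have [E1 E2 U1 _] := h7 ui; have [_ _ _ U2] := h7 vi.
case: eqVneq => [<-|uv]; first by case: s.
case: s => /=.
  rewrite nedges_to in U2; apply: sum_edges_eq0 U2 _ _.
  by apply: off; rewrite // eq_sym.
by rewrite nedges_from in U1; exact: sum_edges_eq0 U1 _ (off u v ui vi uv).
Qed.

(** The last conjunct of the half-linked case, a count over sources, is kept for use with the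
    converse digraph. *)
Lemma cross_edges i j : i != j ->
    (exists f, forall s, {in VP i & VP j, forall u v,
       e (side Phi s u) (side Phi (~~ s) v) = f}) \/
    [/\ delta i = delta j,
        {in VP i & VP j, forall u v, e u (Phi v) = ~~ e (Phi u) v},
        forall s, {in VP i, forall u,
         (\sum_(v in VP j) e (side Phi s u) (side Phi (~~ s) v))%N.*2 = #|VP j|}
      & {in VP j, forall v, (\sum_(u in VP i) e u (Phi v))%N.*2 = #|VP i|}].
Proof.
move=> ij.
have U : unlinked e (VP i) (VP' j) /\ unlinked e (VP' i) (VP j) ->
    exists f, forall s, {in VP i & VP j, forall u v,
       e (side Phi s u) (side Phi (~~ s) v) = f}.
  case=> H1 H2; exists false => -[] u v ui vj.
    exact: unlinkedP H2 (Phi_VP' ui) vj.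
  exact: unlinkedP H1 ui (Phi_VP' vj).
have L : fully_linked e (VP i) (VP' j) /\ fully_linked e (VP' i) (VP j) ->
    exists f, forall s, {in VP i & VP j, forall u v,
       e (side Phi s u) (side Phi (~~ s) v) = f}.
  case=> H1 H2; exists true => -[] u v ui vj.
    exact: fully_linkedP H2 (Phi_VP' ui) vj.
  exact: fully_linkedP H1 ui (Phi_VP' vj).
have [dij|/eqP dij] := eqVneq (delta i) (delta j); last first.
  by left; have [[/U H|/L H] _] := h8_neq ij dij.
case: (h8_eq ij dij) => [/U|/L|[H1 H2 H3 H4]]; [by left|by left|right].
split=> // [u v ui vj|s u ui|v vj].
- have := H4 u _ v ui (Phi_VP' vj) vj erefl.
  by case: (e u (Phi v)); case: (e (Phi u) v) => -[a b] //=; [case: (a isT)|case: (b _)].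
- case: s => /=; first exact: half_linkedP H2 (Phi_VP' ui).
  by have := half_linkedP H1 ui; rewrite sum_VP' card_VP'.
by have := H3 _ (Phi_VP' vj); rewrite half_linked_toE => /eqP.
Qed.

Lemma switchable_digraph : switchable V X Phi VP WP delta e.
Proof.
split.
- move=> i x s xX; case: s; [have [_ H] := h2 i xX|have [_ H] := h1 i xX];
    have [f Hf] := linked_const H; exists f => v vi; apply: Hf; rewrite ?inE //.
  exact: Phi_VP'.
- move=> k x xX; have [_ [H|H|H]] := h4 k xX.
  + left; have [f Hf] := linked_const (or_introl H).
    by exists f => w wk; apply: Hf; rewrite ?inE.
  + by right; apply/eqP; rewrite -half_linked_toE.
  left; have [f Hf] := linked_const (or_intror H).
  by exists f => w wk; apply: Hf; rewrite ?inE.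
- move=> k l w w' wk wk'; case: W_equitable => _ _ _ /(_ k l w w' wk wk') [H _].
  by rewrite -!nedges_from.
- move=> i k; have [/linked_const [f Hf] _] := h6 i k; exists f => s v w vi wk.
  by apply: Hf => //; have := side_mem s vi; rewrite inE; case: s => ->; rewrite ?orbT.
- by case: Phi_iso.
- move=> i j u u' ui ui'; case: V_equitable => _ _ _ /(_ i j u u' ui ui') [H _].
  by rewrite -!nedges_from.
- exact: matching_edges.
- by move=> i j /cross_edges [H|[d H1 H2 _]]; [left|right].
- move=> i j ij dij; have [_ H] := h8_neq ij dij; apply: linked_const.
  by case: H => -[]; [left|right].
- move=> i u v ui vi; have [-> _] := h3 ui (Phi_VP' vi).
  by rewrite !nedges_from.
by move=> k w w' wk wk'; have [H _] := h5 wk wk'; rewrite -!nedges_from.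
Qed.

Lemma switchable_converse : switchable V X Phi VP WP delta (converse e).
Proof.
split; rewrite /converse.
- move=> i x s xX; case: s; [have [H _] := h2 i xX|have [H _] := h1 i xX];
    have [f Hf] := linked_const H; exists f => v vi; apply: Hf; rewrite ?inE //.
  exact: Phi_VP'.
- move=> k x xX; have [[H|H|H] _] := h4 k xX.
  + left; have [f Hf] := linked_const (or_introl H).
    by exists f => w wk; apply: Hf; rewrite ?inE.
  + by right; apply/eqP; rewrite -half_linked1E.
  left; have [f Hf] := linked_const (or_intror H).
  by exists f => w wk; apply: Hf; rewrite ?inE.
- move=> k l w w' wk wk'; case: W_equitable => _ _ _ /(_ k l w w' wk wk') [_ H].
  by rewrite -!nedges_to.
- move=> i k; have [_ /linked_const [f Hf]] := h6 i k; exists f => s v w vi wk.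
  by apply: Hf => //; have := side_mem s vi; rewrite inE; case: s => ->; rewrite ?orbT.
- by case: Phi_iso => _ _ H u v uV vV; rewrite H.
- move=> i j u u' ui ui'; case: V_equitable => _ _ _ /(_ i j u u' ui ui') [_ H].
  by rewrite -!nedges_to.
- move=> i s u v ui vi; rewrite eq_sym -(matching_edges (~~ s) vi ui).
  by rewrite negbK.
- move=> i j ij; have ji : j != i by rewrite eq_sym.
  have [[f H]|[d H1 _ H3]] := cross_edges ji.
    by left; exists f => s u v ui vj; rewrite -(H (~~ s) v u vj ui) negbK.
  right; split=> // [u v ui vj|s u ui]; first by rewrite (H1 v u vj ui) negbK.
  case: s => /=; first exact: H3.
  (* The hypothesis counts only the edges from V_j into a vertex of V_i'. Complementarity under
     exchanging the copies makes the edges from V_j' into the matching vertex of V_i the other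
     half. *)
  have E : (\sum_(v in VP j) e (Phi v) u + \sum_(v in VP j) e v (Phi u) = #|VP j|)%N.
    rewrite -big_split -sum1_card; apply: eq_bigr => v vj /=.
    by rewrite (H1 v u vj ui); case: (e (Phi v) u).
  have := H3 u ui; lia.
- move=> i j ij dij; have ji : j != i by rewrite eq_sym.
  have [_ H] := h8_neq ji (fun E => dij (esym E)).
  have [|f Hf] := @linked_const (VP j) (VP i); first by case: H => -[]; [left|right].
  by exists f => u v ui vj; exact: Hf.
- move=> i u v ui vi; have [_ ->] := h3 ui (Phi_VP' vi).
  by rewrite !nedges_to.
by move=> k w w' wk wk'; have [_ H] := h5 wk wk'; rewrite -!nedges_to.
Qed.

End FromLinking.

Theorem theorem19 (T : finType) (e : rel T) (V V' W X : {set T})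
  (Phi : T -> T) (p q : nat)
  (VP VP' : 'I_p -> {set T}) (WP : 'I_q -> {set T}) (delta : 'I_p -> int)
  (G_simple : simple_digraph e)
  (G_cover : V :|: V' :|: W :|: X = [set: T])
  (G_disjoint : [/\ [disjoint V & V'], [disjoint V & W], [disjoint V & X],
     [disjoint V' & W] & [disjoint V' & X] /\ [disjoint W & X]])
  (Phi_iso : induced_iso e V V' Phi)
  (V_equitable : equitable_partition e V VP)
  (V'_equitable : equitable_partition e V' VP')
  (VP'_def : forall i, VP' i = Phi @: VP i)
  (W_equitable : equitable_partition e W WP)
  (h1 : forall i x, x \in X ->
     (unlinked e [set x] (VP i) \/ fully_linked e [set x] (VP i)) /\
     (unlinked e (VP i) [set x] \/ fully_linked e (VP i) [set x]))
  (h2 : forall i x, x \in X ->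
     (unlinked e [set x] (VP' i) \/ fully_linked e [set x] (VP' i)) /\
     (unlinked e (VP' i) [set x] \/ fully_linked e (VP' i) [set x]))
  (h3 : forall i v v', v \in VP i -> v' \in VP' i ->
     delta i = (nedges e [set v'] X)%:Z - (nedges e [set v] X)%:Z /\
     delta i = (nedges e X [set v'])%:Z - (nedges e X [set v])%:Z)
  (h4 : forall k x, x \in X ->
     [\/ unlinked e [set x] (WP k), half_linked e [set x] (WP k)
       | fully_linked e [set x] (WP k)] /\
     [\/ unlinked e (WP k) [set x], half_linked_to e (WP k) x
       | fully_linked e (WP k) [set x]])
  (h5 : forall k w w', w \in WP k -> w' \in WP k ->
     nedges e [set w] X = nedges e [set w'] X /\
     nedges e X [set w] = nedges e X [set w'])
  (h6 : forall i k,
     (unlinked e (VP i :|: VP' i) (WP k) \/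
      fully_linked e (VP i :|: VP' i) (WP k)) /\
     (unlinked e (WP k) (VP i :|: VP' i) \/
      fully_linked e (WP k) (VP i :|: VP' i)))
  (h7 : forall i v, v \in VP i ->
     [/\ e v (Phi v), e (Phi v) v,
         nedges e [set v] (VP' i :\ Phi v) = 0%N
       & nedges e (VP' i :\ Phi v) [set v] = 0%N])
  (h8_neq : forall i j, i != j -> delta i <> delta j ->
     ((unlinked e (VP i) (VP' j) /\ unlinked e (VP' i) (VP j)) \/
      (fully_linked e (VP i) (VP' j) /\ fully_linked e (VP' i) (VP j))) /\
     ((unlinked e (VP i) (VP j) /\ unlinked e (VP' i) (VP' j)) \/
      (fully_linked e (VP i) (VP j) /\ fully_linked e (VP' i) (VP' j))))
  (h8_eq : forall i j, i != j -> delta i = delta j ->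
     [\/ unlinked e (VP i) (VP' j) /\ unlinked e (VP' i) (VP j),
         fully_linked e (VP i) (VP' j) /\ fully_linked e (VP' i) (VP j)
       | [/\ half_linked e (VP i) (VP' j),
             half_linked e (VP' i) (VP j),
             forall v', v' \in VP' j -> half_linked_to e (VP i) v'
           & forall v v' u, v \in VP i -> v' \in VP' j ->
               u \in VP j -> Phi u = v' ->
               (e v v' <-> ~ e (Phi v) u)]]) :
  let e' := switch_all e X
              ([set VP i :|: VP' i | i : 'I_p] :|: [set WP k | k : 'I_q]) in
  zeta_equivalent e e' /\ zeta_equivalent (dcompl e) (dcompl e').
Proof.
have [Phi_inj Phi_V _] := Phi_iso.
have [_ VP_disj VP_cover _] := V_equitable.
have [_ WP_disj WP_cover _] := W_equitable.
have G := switchable_digraph Phi_iso V_equitable VP'_def W_equitable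
  h1 h2 h3 h4 h5 h6 h7 h8_neq h8_eq.
have Gc := switchable_converse Phi_iso V_equitable VP'_def W_equitable
  h1 h2 h3 h4 h5 h6 h7 h8_neq h8_eq.
move=> e'.
have simple' : simple_digraph e'.
  move=> x; rewrite -[RHS](G_simple x); apply: switch_all_same => //.
  exact: (switch_sets_disjoint G_disjoint Phi_V VP_cover VP'_def WP_cover).
(* The two [erefl] set [al0] and [tau] to the values dictated by the pencil, whose coefficients stay
   free; the digraph and its complement are both instances. *)
have det_eq := pencil_det_switch G_cover G_disjoint Phi_inj Phi_V VP_disj VP_cover
  VP'_def WP_disj WP_cover fraction_mpoly_pchar0 _ _ G Gc erefl erefl.
have compl_simple (r : rel T) : simple_digraph (dcompl r).
  by move=> x; rewrite /dcompl /= eqxx.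
have eta_eq : eta e = eta e'.
  apply: eta_eq_pencil; apply: det_eq => i; exact: weights_neq0.
split; first exact: And4 G_simple simple' erefl eta_eq.
apply: (And4 (compl_simple e) (compl_simple e') erefl).
apply: (eta_compl_eq_pencil G_simple simple') => x; apply: det_eq => i.
(* For the complement all four weights are negated, hence so are a and b, and the sum of their
   squares is unchanged. *)
rewrite -!opprD !(mulrN, mulNr) !sqrrN; exact: weights_neq0.
Qed.
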